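(* Assume $\Delta=0$ (so the equations are $\delta u=\alpha u^{(p)}$). 1) There is a Zariski closed subset $\Omega\subset GL_n(K^a)$ with $1\notin\Omega$ such that for every $u\in GL_n(R)\setminus\Omega$ the following holds: setting $\alpha=\delta u\cdot(u^{(p)})^{-1}$, for every valuation $\delta$-subring $\mathcal O$ of $R$ containing the entries of $\alpha$, the group $G_{u/\mathcal O}$ contains a normal subgroup of finite index which is diagonalizable (i.e. conjugate in $GL_n(K^a)$ to a group of diagonal matrices). 2) There is a subset $\Omega$ of the first category in the metric space $X=\{u\in GL_n(R): u\equiv 1\bmod p\}$ (with the $p$-adic metric) such that for every $u\in X\setminus\Omega$ the following holds: setting $\alpha=\delta u\cdot(u^{(p)})^{-1}$, there exists a valuation $\delta$-subring $\mathcal O$ of $R$ containing $R^\delta$ with $\alpha\in\mathfrak{gl}_n(\mathcal O)$ and $G_{u/\mathcal O}=N^\delta$.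
   Context: Let $p$ be an odd prime, $R$ the unique complete discrete valuation ring with maximal ideal $pR$ and residue field an algebraic closure of $\mathbb F_p$, $K$ its fraction field, $K^a$ an algebraic closure of $K$. $\phi:R\to R$ is the unique lift of Frobenius, $\delta a=(\phi(a)-a^p)/p$; on matrices $\phi,\delta$ act entrywise and $u^{(p)}=(u_{ij}^p)$. $R^\delta=\{\lambda\in R:\delta\lambda=0\}$ (zero and the roots of unity). A $\delta$-subring of $R$ is a subring closed under $\delta$; a valuation subring of $R$ is the intersection of $R$ with a subfield of $K$. A subset of a metric space is of the first category if it is a countable union of sets whose closures have empty interior. For a $\delta$-subring $\mathcal O$, $\alpha\in\mathfrak{gl}_n(\mathcal O)$ and $u\in GL_n(R)$ with $\delta u=\alpha u^{(p)}$: $\mathcal O\{u\}$ is the subring of $R$ generated by $\mathcal O$ and the entries of $u,\delta u,\delta^2u,\dots$; $\tilde G_{u/\mathcal O}$ is the group of $\mathcal O$-algebra automorphisms $\sigma$ of $\mathcal O\{u\}$ commuting with $\delta$ and satisfying $u^{-1}\sigma(u)\in GL_n(\mathcal O)$; $G_{u/\mathcal O}$ is the image of the injective homomorphism $\tilde G_{u/\mathcal O}\to GL_n(\mathcal O)$, $\sigma\mapsto u^{-1}\sigma(u)$. $T\subset GL_n(R)$ is the group of diagonal matrices, $W$ the group of permutation matrices, $N=WT$; $N^\delta$ is the subgroup of $N$ of matrices all of whose entries lie in $R^\delta$ (equivalently $N^\delta=WT^\delta$, $T^\delta$ the diagonal matrices with root-of-unity diagonal entries). *)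

(* Defs.v *)
From HB Require Import structures.
From mathcomp Require Import all_boot all_order all_algebra all_fingroup.
From mathcomp Require Import fraction.
From mathcomp Require Import mpoly.
Set Implicit Arguments. Unset Strict Implicit. Unset Printing Implicit Defensive.
Import Order.TTheory GRing.Theory Num.Theory.
Local Open Scope ring_scope.

Section Defs.
Variable R : idomainType.
Variable p : nat.

Definition pdvd (k : nat) (x : R) : Prop := exists y, x = (p%:R ^+ k) * y.

(* R is the complete DVR with maximal ideal pR and residue field an algebraic
   closure of F_p (i.e. R = W(F_p^a)); this characterizes R up to isomorphism. *)
Definition Witt_Fpbar : Prop :=
  p%:R != 0 :> R /\
  [/\ (p%:R : R) \isn't a GRing.unit,
      (forall x : R, x != 0 -> exists k v, v \is a GRing.unit /\ x = p%:R ^+ k * v),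
      (forall s : nat -> R,
        (forall k, exists N, forall m, (N <= m)%N -> pdvd k (s m - s N)) ->
        exists l, forall k, exists N, forall m, (N <= m)%N -> pdvd k (s m - l)),
      (forall q : {poly R}, q \is monic -> (1 < size q)%N -> exists a, pdvd 1 q.[a])
    & (* residue field algebraic over F_p *)
      (forall a : R, exists m, (0 < m)%N /\ pdvd 1 (a ^+ (p ^ m) - a))].

Definition Frob_lift (phi : {rmorphism R -> R}) : Prop :=
  forall a, pdvd 1 (phi a - a ^+ p).

Definition delta_spec (phi : {rmorphism R -> R}) (delta : R -> R) : Prop :=
  forall a, p%:R * delta a = phi a - a ^+ p.

Variable delta : R -> R.

Definition subring (S : R -> Prop) : Prop :=
  S 1 /\ forall x y, S x -> S y -> S (x - y) /\ S (x * y).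

Definition delta_subring (S : R -> Prop) : Prop :=
  subring S /\ forall x, S x -> S (delta x).

Definition subfield_K (F : {fraction R} -> Prop) : Prop :=
  F 1 /\ (forall x y, F x -> F y -> F (x - y) /\ F (x * y)) /\
  (forall x, F x -> F x^-1).

Definition valuation_subring (O : R -> Prop) : Prop :=
  exists F, subfield_K F /\ forall x : R, O x <-> F (FracField.tofrac x).

Definition Rdelta (x : R) : Prop := delta x = 0.

Variable n : nat.

Definition mx_over (S : R -> Prop) (A : 'M[R]_n) : Prop := forall i j, S (A i j).

Definition GL_over (S : R -> Prop) (g : 'M[R]_n) : Prop :=
  g \in unitmx /\ mx_over S g /\ mx_over S (invmx g).

Definition alpha_of (u : 'M[R]_n) : 'M[R]_n :=
  map_mx delta u *m invmx (map_mx (fun x => x ^+ p) u).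

Definition gen_ring (O : R -> Prop) (u : 'M[R]_n) : R -> Prop :=
  fun x => forall S, subring S -> (forall a, O a -> S a) ->
    (forall k i j, S (iter k (map_mx delta) u i j)) -> S x.

(* G_{u/O}: image of the group of delta-O-algebra automorphisms sigma of O{u}
   with u^-1 sigma(u) in GL_n(O) under sigma |-> u^-1 sigma(u) *)
Definition Gal_group (O : R -> Prop) (u : 'M[R]_n) : 'M[R]_n -> Prop :=
  fun g => GL_over O g /\
    exists sigma : R -> R,
      let A := gen_ring O u in
      [/\ (forall x, A x -> A (sigma x)) /\
          (forall y, A y -> exists x, A x /\ sigma x = y) /\
          (forall x y, A x -> A y -> sigma x = sigma y -> x = y),
          forall x y, A x -> A y ->
            sigma (x + y) = sigma x + sigma y /\ sigma (x * y) = sigma x * sigma y,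
          forall a, O a -> sigma a = a,
          forall x, A x -> sigma (delta x) = delta (sigma x)
        & invmx u *m map_mx sigma u = g].

Definition is_subgroup (H : 'M[R]_n -> Prop) : Prop :=
  H 1%:M /\ (forall g, H g -> g \in unitmx) /\
  forall g h, H g -> H h -> H (g *m invmx h).

Variable Ka : closedFieldType.
Variable iota : {rmorphism {fraction R} -> Ka}.

Definition algebraic_closure_of_K : Prop :=
  forall z : Ka, exists q : {poly {fraction R}}, q != 0 /\ root (map_poly iota q) z.

Definition toKa (x : R) : Ka := iota (FracField.tofrac x).

Definition has_diag_normal_finite_index (G : 'M[R]_n -> Prop) : Prop :=
  exists H : 'M[R]_n -> Prop,
    [/\ is_subgroup H,
        forall h, H h -> G h,
        forall g h, G g -> H h -> H (g *m h *m invmx g),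
        exists m (c : 'I_m -> 'M[R]_n), (forall i, G (c i)) /\
          forall g, G g -> exists i, H (invmx (c i) *m g)
      & exists P : 'M[Ka]_n, P \in unitmx /\
          forall h, H h -> is_diag_mx (invmx P *m map_mx toKa h *m P)].

Definition zariski_closed_GL (Om : 'M[Ka]_n -> Prop) : Prop :=
  exists S : {mpoly Ka[n * n]} -> Prop,
    forall M, Om M <-> (M \in unitmx /\
                        forall f, S f -> f.@[fun i => mxvec M 0 i] = 0).

Definition Xset (u : 'M[R]_n) : Prop := forall i j, pdvd 1 ((u - 1%:M) i j).

(* u and v at distance <= p^-k *)
Definition close (k : nat) (u v : 'M[R]_n) : Prop := forall i j, pdvd k ((u - v) i j).

Definition closure_X (A : 'M[R]_n -> Prop) : 'M[R]_n -> Prop :=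
  fun u => Xset u /\ forall k, exists v, A v /\ Xset v /\ close k u v.

Definition empty_interior_X (B : 'M[R]_n -> Prop) : Prop :=
  ~ exists u k, Xset u /\ forall v, Xset v -> close k u v -> B v.

Definition first_category_X (Om : 'M[R]_n -> Prop) : Prop :=
  (forall u, Om u -> Xset u) /\
  exists A : nat -> 'M[R]_n -> Prop,
    (forall u, Om u <-> exists m, A m u) /\
    forall m, empty_interior_X (closure_X (A m)).

Definition Ndelta (M : 'M[R]_n) : Prop :=
  (exists (s : 'S_n) (d : 'rV[R]_n),
      (forall i, d 0 i \is a GRing.unit) /\ M = perm_mx s *m diag_mx d) /\
  forall i j, Rdelta (M i j).

End Defs.

(* Main.v *)
(** Write V(u) for the entrywise p-th power.  An element g of the Galois group satisfies
    V(u) phi(g) = V(u g); p-th powers gain a p-adic digit and phi loses none, so g is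
    determined by its residue mod p.  Since GL_n of the algebraic closure of F_p is locally
    finite, so is the Galois group, for every u: in part 1 Omega can be empty, and the claim
    is the Jordan-Schur theorem.  For a finite group, the matrix entries are specialised to
    algebraic numbers, the group is made unitary, and its elements close to 1 commute; an
    ultrafilter glues the finite subgroups together.

    In part 2 let F be the field generated by R^delta and the entries of
    phi^k (phi(u) V(u)^-1), and take O to be its intersection with R.  Outside countably many
    nowhere dense sets the entries of u are algebraically independent over F.  Then
    V(u) phi(g) = V(u g) holds identically in u, which forces g to be monomial with entries
    in R^delta, and conversely u |-> u g extends to O[u].  The nowhere density is shown on
    points u0 + p^m sum_j z^j t_j with natural number coordinates t_j: a Vandermonde matrix
    in the phi^i z turns (u, phi u, ..., phi^r u) into independent variables. *)

From HB Require Import structures.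
From Stdlib Require Import ClassicalEpsilon.
Require Import Defs.
From mathcomp Require Import all_boot all_order all_algebra all_fingroup all_field.
From mathcomp Require Import fraction.
From mathcomp Require Import mpoly.
From mathcomp Require Import ring zify.
From mathcomp Require filter.
Set Implicit Arguments. Unset Strict Implicit. Unset Printing Implicit Defensive.
Import Order.TTheory GRing.Theory Num.Theory.
Local Open Scope ring_scope.

(** * Specialisation of finitely generated domains *)

(** Unitary matrices are usually reached by embedding K into the complex numbers. A finite group
    involves finitely many entries only, so a specialisation of a finitely generated ring does the
    same, and it can take values in the algebraic numbers, whose archimedean order allows cutting
    the unitary matrices into finitely many small boxes. The number of boxes depends on n alone, so
    the bound survives the limit over finite subgroups.

    In part 2 the obstacle is that F itself depends on u. With c_k = phi^k(phi(u) V(u)^-1), the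
    tuples (u, phi u, ..., phi^r u) and (u, c_0, ..., c_(r-1)) determine each other, as variables
    congruent to 1 mod p. Independence of u over F thus amounts to avoiding polynomial relations
    among u and the c_k over R^delta, and these are countably many because R^delta is countable. The
    map phi is not polynomial, but it fixes natural numbers; on a perturbation with such coordinates
    t_j every phi^i u is an affine function of the t_j. *)

Lemma ex_minimal (T : Type) (P : T -> Prop) (m : T -> nat) :
  (exists x, P x) -> exists x, P x /\ forall y, P y -> (m x <= m y)%N.
Proof.
case=> x; have [k] := ubnP (m x); elim: k x => // k IHk x le_k Px.
have [[y [Py lt_yx]]|min_x] := classic (exists y, P y /\ (m y < m x)%N).
  by apply: (IHk y) => //; apply: leq_trans lt_yx _.
exists x; split=> // y Py; rewrite leqNgt; apply/negP => lt_yx.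
by case: min_x; exists y.
Qed.

Lemma poly_nonroot_seq (R : idomainType) (q : {poly R}) (f : nat -> R) :
  q != 0 -> injective f -> exists m, q.[f m] != 0.
Proof.
move=> q0 f_inj; pose s := map f (iota 0 (size q)).
have us : uniq s by rewrite map_inj_uniq ?iota_uniq.
have [sr|] := boolP (all (root q) s).
  by have := max_poly_roots q0 sr us; rewrite size_map size_iota ltnn.
by case/allPn=> _ /mapP[i _ ->] nr; exists i.
Qed.

Lemma natr_inj (R : idomainType) :
  [pchar R] =i pred0 -> injective (fun m : nat => m%:R : R).
Proof.
move/pcharf0P => char0 i j /eqP; wlog ij : i j / (i <= j)%N.
  by move=> h; case/orP: (leq_total i j) => [/h//|/h ji]; rewrite eq_sym => /ji.
rewrite eq_sym -subr_eq0 -natrB // char0 subn_eq0 => ji.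
by apply/eqP; rewrite eqn_leq ij.
Qed.

Section Specialization.
Variables (F : fieldType) (C : numClosedFieldType).

(** The first condition says that psi factors through the image of [ev]. Working with a presentation
    A -> F instead of a subring of F makes adjoining an element a mere passage to [{poly A}]. *)
Definition specializable (A : idomainType) (ev : {rmorphism A -> F}) : Prop :=
  forall g, ev g != 0 -> exists psi : {rmorphism A -> C},
    (forall f, ev f = 0 -> psi f = 0) /\ psi g != 0.

Section Adjoin.
Variables (A : idomainType) (ev : {rmorphism A -> F}) (x : F).

Let cx : commr_rmorph ev x := fun a => mulrC x (ev a).
Let E : {rmorphism {poly A} -> F} := horner_morph cx.
Let M : {rmorphism {poly A} -> {poly F}} := map_poly ev.

Let EE p : E p = (M p).[x]. Proof. by []. Qed.

Let EC c : E c%:P = ev c.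
Proof. by rewrite EE /M /= map_polyC hornerC. Qed.

Let size_M p : (size (M p) <= size p)%N.
Proof. exact: size_poly. Qed.

(** The leading coefficient of q may die under [ev]; dropping such coefficients keeps [M q] and
    makes degrees over A and F agree. *)
Let truncM q : M q != 0 -> exists q', M q' = M q /\ size q' = size (M q).
Proof.
move=> q0; pose q' := \poly_(i < size (M q)) q`_i.
have Mq' : M q' = M q.
  apply/polyP => i; rewrite coef_map coef_poly coef_map.
  by case: ltnP => // le; rewrite -[RHS]coef_map [RHS]nth_default //; apply: rmorph0.
exists q'; split=> //; apply/eqP; rewrite eqn_leq size_poly /=.
by rewrite -[in leqLHS]Mq' size_M.
Qed.

Let lead_neq0 (q : {poly A}) : size q = size (M q) -> M q != 0 -> ev (lead_coef q) != 0.
Proof.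
by move=> sq q0; rewrite lead_coefE sq -coef_map -/(lead_coef (M q)) lead_coef_eq0.
Qed.

(* For x algebraic, q is a nonzero relation of minimal degree.  A pseudo-division argument
   shows that g divides, modulo q, a nonzero constant a; any map that kills neither a nor the
   leading coefficient of q extends by sending x to a root of q. *)
Lemma specializable_adjoin : specializable ev -> specializable E.
Proof.
move=> spec g Eg.
have Ediv f h : ev (lead_coef h) ^+ Pdiv.Idomain.scalp f h * E f
    = E (f %/ h) * E h + E (f %% h).
  rewrite -rmorphM -rmorphD -Pdiv.Idomain.divp_eq -mul_polyC rmorphM.
  by rewrite EC rmorphXn.
have [[q0 [Eq0 Mq0]]|transc] := classic (exists q, E q = 0 /\ M q != 0); last first.
  have Mz f : E f = 0 -> M f = 0.
    move=> Ef; apply/eqP; apply: contraT => Mf; case: transc; by exists f.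
  (* For x transcendental over the image, x may go to any natural number that is not a root of the
     specialised g. *)
  have [i gi] : exists i, ev g`_i != 0.
    have Mg : M g != 0 by apply: contraNneq Eg => Mg; rewrite EE Mg horner0.
    by exists (size (M g)).-1; rewrite -coef_map -/(lead_coef _) lead_coef_eq0.
  have [psi [psi0 psig]] := spec _ gi.
  have [m ym] : exists m : nat, (map_poly psi g).[m%:R] != 0.
    apply: poly_nonroot_seq (natr_inj (pchar_num C)).
    by apply: contraNneq psig => pg; rewrite -coef_map pg coef0.
  exists (horner_morph (fun a => mulrC (m%:R : C) (psi a))); split=> // f Ef.
  rewrite /= /horner_morph (_ : map_poly psi f = 0) ?horner0 //.
  apply/polyP => j; rewrite coef0 coef_map; apply: psi0; rewrite -coef_map.
  by rewrite [map_poly _ _]Mz // coef0.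
have [q1 [[Eq1 Mq1] min_q1]] :=
  @ex_minimal _ (fun q => E q = 0 /\ M q != 0) (fun q => size (M q))
    (ex_intro _ q0 (conj Eq0 Mq0)).
have [q [Mqq1 sq]] := truncM Mq1.
rewrite -Mqq1 in sq Mq1 min_q1; have {}Eq1 : E q = 0 by rewrite EE Mqq1 -EE.
have {}min_q1 (f : {poly A}) : E f = 0 -> (size (M f) < size (M q))%N -> M f = 0.
  move=> Ef lt; apply/eqP; apply: contraTT lt => Mf; rewrite -leqNgt.
  exact: min_q1.
have lq := lead_neq0 sq Mq1.
have q_neq0 : q != 0 by apply: contraNneq Mq1 => ->; rewrite rmorph0.
(* P collects the nonzero multiples of g modulo the relations of x; one of least degree will turn
   out to be constant. *)
pose P (s : {poly A}) := E s != 0 /\ exists b, E s = E b * E g.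
have [s1 [[Es1 [b1 Hb1]] min_s1]] : exists s : {poly A}, P s /\ forall s' : {poly A}, P s' ->
    (size (M s) <= size (M s'))%N.
  by apply: ex_minimal; exists g; split=> //; exists 1; rewrite rmorph1 mul1r.
have Ms1 : M s1 != 0 by apply: contraNneq Es1 => h; rewrite EE h horner0.
have [s [Mss ss]] := truncM Ms1.
have EsE : E s = E s1 by rewrite !EE Mss.
rewrite -EsE in Es1 Hb1; rewrite -Mss in min_s1 ss Ms1 => {s1 Mss EsE}.
have ls := lead_neq0 ss Ms1.
have s_neq0 : s != 0 by apply: contraNneq Ms1 => ->; rewrite rmorph0.
have le_sq : (size (M s) <= size (M q))%N.
  rewrite leqNgt; apply/negP => lt.
  have Prem : P (s %% q).
    have e : E (s %% q) = ev (lead_coef q) ^+ Pdiv.Idomain.scalp s q * E s.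
      by rewrite Ediv Eq1 mulr0 add0r.
    split; first by rewrite e mulf_neq0 // expf_neq0.
    exists ((lead_coef q ^+ Pdiv.Idomain.scalp s q)%:P * b1).
    rewrite rmorphM -mulrA -Hb1 e; congr (_ * _).
    by rewrite EC rmorphXn.
  have := min_s1 _ Prem; rewrite leqNgt => /negP; apply.
  by apply: leq_ltn_trans (size_M _) (leq_trans _ (ltnW lt)); rewrite -sq ltn_modp.
(* Divide q by s. Unless the quotient vanishes at x, the remainder is a multiple of g of lower
   degree; but a quotient vanishing at x contradicts the minimality of q for degree reasons. *)
have s_const : (size s <= 1)%N.
  rewrite leqNgt; apply/negP => s_gt1.
  have e := Ediv q s; rewrite Eq1 mulr0 in e.
  have lt_rem : (size (M (q %% s)%R) < size (M s))%N.
    by apply: leq_ltn_trans (size_M _) _; rewrite -ss ltn_modp.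
  have Ec : E (q %/ s) = 0.
    apply/eqP; apply: contraT => Ec.
    have er : E (q %% s) = - E (q %/ s) * E s.
      by apply/eqP; rewrite mulNr -addr_eq0 addrC -e.
    have Prem : P (q %% s).
      split; first by rewrite er mulf_neq0 ?oppr_eq0.
      by exists (- (q %/ s) * b1); rewrite rmorphM rmorphN -mulrA -Hb1.
    by have := min_s1 _ Prem; rewrite leqNgt lt_rem.
  have Me : ev (lead_coef s) ^+ Pdiv.Idomain.scalp q s *: M q
      = M (q %/ s) * M s + M (q %% s).
    rewrite -rmorphM -rmorphD -Pdiv.Idomain.divp_eq /M /=.
    by rewrite map_polyZ /= rmorphXn.
  have sz : size (M q) = size (M (q %/ s) * M s + M (q %% s)).
    by rewrite -Me size_scale // expf_neq0.
  have [Mc|Mc] := eqVneq (M (q %/ s)) 0.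
    move: sz; rewrite Mc mul0r add0r => sz.
    by move: lt_rem; rewrite -sz ltnNge le_sq.
  have le_qc : (size (M q) <= size (M (q %/ s)%R))%N.
    rewrite leqNgt; apply/negP => lt; by rewrite (min_q1 _ Ec lt) eqxx in Mc.
  have sz2 : (size (M q) < size (M (q %/ s) * M s)%R)%N.
    rewrite size_mul // -ss; case: (size s) s_gt1 => [|[|k]] // _.
    by rewrite !addnS /= ltnS (leq_trans le_qc) ?leq_addr.
  move: sz; rewrite size_polyDl; first by move=> h; rewrite -h ltnn in sz2.
  by apply: ltn_trans lt_rem (leq_ltn_trans le_sq sz2).
have [a sa] : exists a, s = a%:P by exists s`_0; rewrite [LHS]size1_polyC.
have Ea : E s = ev a by rewrite sa EC.
have [psi [psi0 psia]] : exists psi : {rmorphism A -> C},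
    (forall f, ev f = 0 -> psi f = 0) /\ psi (a * lead_coef q) != 0.
  by apply: spec; rewrite rmorphM mulf_neq0 // -Ea.
rewrite rmorphM mulf_eq0 negb_or in psia; case/andP: psia => psia psil.
have [y ry] : exists y, root (map_poly psi q) y.
  apply/closed_rootP; rewrite size_map_poly_id0 // sq.
  apply/negP => /size_poly1P [c c0 Mc].
  by move: Eq1; rewrite EE Mc hornerC => c00; rewrite c00 eqxx in c0.
pose psi' : {rmorphism {poly A} -> C} := horner_morph (fun a => mulrC y (psi a)).
have psi'E f : psi' f = (map_poly psi f).[y] by [].
have psi'C c : psi' c%:P = psi c by rewrite psi'E map_polyC hornerC.
have psi'0 f : E f = 0 -> psi' f = 0.
  move=> Ef.
  have Er : E (f %% q) = 0.
    by have := Ediv f q; rewrite Ef Eq1 !mulr0 add0r.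
  have Mr : M (f %% q) = 0.
    apply: min_q1 => //; apply: leq_ltn_trans (size_M _) _.
    by rewrite -sq ltn_modp.
  have pr : map_poly psi (f %% q) = 0.
    apply/polyP => j; rewrite coef0 coef_map; apply: psi0; rewrite -coef_map.
    by rewrite [map_poly _ _]Mr coef0.
  have := congr1 psi' (Pdiv.Idomain.divp_eq f q).
  rewrite -mul_polyC rmorphD !rmorphM psi'C !psi'E pr horner0 addr0.
  rewrite (rootP ry) mulr0 rmorphXn => /eqP.
  by rewrite mulf_eq0 (negPf (expf_neq0 _ psil)) => /eqP.
exists psi'; split=> //; apply: contraNneq psia => pg.
have : psi' (b1 * g - a%:P) = 0.
  by apply: psi'0; rewrite rmorphB rmorphM -Hb1 -sa subrr.
rewrite rmorphB rmorphM pg mulr0 sub0r psi'C => /eqP.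
by rewrite oppr_eq0.
Qed.

End Adjoin.

Lemma specialization_ring (xs : seq F) : [pchar F] =i pred0 ->
  exists (A : idomainType) (ev : {rmorphism A -> F}),
    specializable ev /\ forall x, x \in xs -> exists a, ev a = x.
Proof.
move/pcharf0P => charF; elim: xs => [|x xs [A [ev [spec IH]]]].
  exists int, (intmul (1 : F)); split=> // g g0.
  exists (intmul (1 : C)); split=> [f /eqP|]; last first.
    by rewrite intr_eq0; apply: contraNneq g0 => ->.
  have int0 (z : int) : (z%:~R == 0 :> F) = (z == 0).
    case: z => k; first by rewrite -pmulrn charF.
    by rewrite NegzE mulrNz oppr_eq0 -pmulrn charF oppr_eq0.
  by rewrite int0 => /eqP->.
exists {poly A}, (horner_morph (fun a => mulrC x (ev a))); split.
  exact: specializable_adjoin.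
move=> z; rewrite inE => /predU1P[->|/IH[a <-]].
  by exists 'X; rewrite /= /horner_morph map_polyX hornerX.
by exists a%:P; rewrite /= /horner_morph map_polyC hornerC.
Qed.

(** The homomorphism is presented as a partial map on F: D is the image of [ev], and [rho] uses an
    arbitrary preimage, harmless because psi kills the kernel of [ev]. *)
Lemma specialization (xs : seq F) (d : F) :
  [pchar F] =i pred0 -> d != 0 ->
  exists (D : F -> Prop) (rho : F -> C),
    [/\ D 1 /\ rho 1 = 1,
        forall x, x \in xs -> D x,
        forall x y, D x -> D y -> D (x + y) /\ rho (x + y) = rho x + rho y,
        forall x y, D x -> D y -> D (x * y) /\ rho (x * y) = rho x * rho y
      & D d /\ rho d != 0].
Proof.
move=> charF d0; have [A [ev [spec im]]] := specialization_ring (d :: xs) charF.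
have [dA evd] : exists a, ev a = d by apply: im; rewrite mem_head.
have [|psi [psi0 psid]] := spec dA; first by rewrite evd.
pose D x := exists a, ev a = x.
pose rho x := psi (epsilon (inhabits 0) (fun a => ev a = x)).
have rhoE a : rho (ev a) = psi a.
  apply/eqP; rewrite -subr_eq0 -rmorphB; apply/eqP/psi0.
  rewrite rmorphB; apply/eqP; rewrite subr_eq0; apply/eqP.
  by apply: (epsilon_spec (inhabits 0) (fun b => ev b = ev a)); exists a.
exists D, rho; split.
- split; first by exists 1; rewrite rmorph1.
  by rewrite -(rmorph1 ev) rhoE rmorph1.
- by move=> x xs_x; apply: im; rewrite inE xs_x orbT.
- move=> _ _ [a <-] [b <-]; split; last by rewrite -rmorphD !rhoE rmorphD.
  by exists (a + b); rewrite rmorphD.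
- move=> _ _ [a <-] [b <-]; split; last by rewrite -rmorphM !rhoE rmorphM.
  by exists (a * b); rewrite rmorphM.
- by rewrite -evd rhoE; split=> //; exists dA.
Qed.

End Specialization.

(** Injectivity on a finite set is a single nonvanishing condition: the product of the nonzero
    differences must survive. *)
Lemma specialization_inj (F : fieldType) (C : numClosedFieldType) (xs : seq F) :
  [pchar F] =i pred0 ->
  exists (D : F -> Prop) (rho : F -> C),
    [/\ D 1 /\ rho 1 = 1,
        forall x, x \in xs -> D x,
        forall x y, D x -> D y -> D (x + y) /\ rho (x + y) = rho x + rho y,
        forall x y, D x -> D y -> D (x * y) /\ rho (x * y) = rho x * rho y
      & {in xs &, injective rho}].
Proof.
move=> charF; pose zs := [seq x - y | x <- xs, y <- xs].
pose ws := [seq z <- zs | z != 0].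
have ws0 : \prod_(z <- ws) z != 0.
  by rewrite prodf_seq_neq0; apply/allP => z; rewrite mem_filter => /andP[].
have [D [rho [[D1 rho1] Dxs DD DM [_ rhod]]]] := specialization C (zs ++ xs) charF ws0.
exists D, rho; split=> //; first by move=> x xs_x; apply: Dxs; rewrite mem_cat xs_x orbT.
have rho_prod : forall s : seq F, (forall z, z \in s -> D z) ->
    D (\prod_(z <- s) z) /\ rho (\prod_(z <- s) z) = \prod_(z <- s) rho z.
  elim=> [|z s IH] Ds; first by rewrite !big_nil.
  have [Dp rp] : D (\prod_(z <- s) z) /\ rho (\prod_(z <- s) z) = \prod_(z <- s) rho z.
    by apply: IH => y sy; apply: Ds; rewrite inE sy orbT.
  have Dz : D z by apply: Ds; rewrite mem_head.
  by rewrite !big_cons -rp; apply: DM.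
have Dws z : z \in ws -> D z.
  by rewrite mem_filter => /andP[_ zz]; apply: Dxs; rewrite mem_cat zz.
rewrite (rho_prod _ Dws).2 prodf_seq_neq0 in rhod; move/allP: rhod => rhod.
move=> x y xs_x xs_y rxy; apply/eqP; rewrite -subr_eq0; apply: contraT => xy.
have xyw : x - y \in ws by rewrite mem_filter xy; apply: allpairs_f.
have Dy : D y by apply: Dxs; rewrite mem_cat xs_y orbT.
have [_] := DD (x - y) y (Dws _ xyw) Dy.
rewrite subrK rxy => /eqP; rewrite -subr_eq subrr eq_sym.
by move=> /eqP h; have := rhod _ xyw; rewrite /= h eqxx.
Qed.

(** * Jordan's theorem for finite unitary groups *)

Section FrobeniusNorm.
Variable C : numClosedFieldType.
Local Open Scope sesquilinear_scope.

Lemma sum_CauchySchwarz (I : finType) (x y : I -> C) :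
  `|\sum_i x i * y i| ^+ 2 <= (\sum_i `|x i| ^+ 2) * (\sum_i `|y i| ^+ 2).
Proof.
pose a i := `|x i|; pose b i := `|y i|.
have s0 : 0 <= \sum_i a i * b i.
  by apply: sumr_ge0 => i _; apply: mulr_ge0; apply: normr_ge0.
have le1 : `|\sum_i x i * y i| <= \sum_i a i * b i.
  by apply: le_trans (ler_norm_sum _ _ _) _; apply: ler_sum => i _; rewrite normrM.
apply: le_trans (_ : (\sum_i a i * b i) ^+ 2 <= _).
  by rewrite ler_sqr ?nnegrE.
have : 0 <= \sum_i \sum_j (a i * b j - a j * b i) ^+ 2.
  apply: sumr_ge0 => i _; apply: sumr_ge0 => j _; apply: real_exprn_even_ge0 => //.
  by rewrite rpredB // rpredM // normr_real.
(* Lagrange's identity. *)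
have -> : \sum_i \sum_j (a i * b j - a j * b i) ^+ 2
  = ((\sum_i a i ^+ 2) * (\sum_i b i ^+ 2) - (\sum_i a i * b i) ^+ 2) *+ 2.
  rewrite mulr2n {1}mulr_suml expr2 mulr_suml -sumrB.
  rewrite [X in _ = _ + (X - _)]mulrC mulr_suml -sumrB -big_split /=.
  apply: eq_bigr => i _; rewrite !mulr_sumr -!sumrB -big_split /=.
  by apply: eq_bigr => j _; ring.
by rewrite pmulrn_lge0 // subr_ge0.
Qed.

(** The square of the Frobenius norm, which avoids square roots. *)
Definition frob2 m n (X : 'M[C]_(m, n)) : C := \sum_i \sum_j `|X i j| ^+ 2.

Lemma frob2E m n (X : 'M[C]_(m, n)) : frob2 X = \tr (X *m X ^t*).
Proof.
apply: eq_bigr => i _; rewrite mxE; apply: eq_bigr => j _.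
by rewrite !mxE normCK.
Qed.

Lemma frob2_ge0 m n (X : 'M[C]_(m, n)) : 0 <= frob2 X.
Proof. by do 2![apply: sumr_ge0 => ? _]; rewrite exprn_ge0. Qed.

Lemma frob2_eq0 m n (X : 'M[C]_(m, n)) : frob2 X = 0 -> X = 0.
Proof.
move=> X0; apply/matrixP => i j; rewrite mxE.
have /psumr_eq0P h1 := X0.
have /psumr_eq0P h2 := h1 (fun i _ => sumr_ge0 _ (fun j _ => exprn_ge0 2 (normr_ge0 (X i j)))) i isT.
have /eqP := h2 (fun j _ => exprn_ge0 2 (normr_ge0 (X i j))) j isT.
by rewrite expf_eq0 /= normr_eq0 => /eqP.
Qed.

Lemma frob2N m n (X : 'M[C]_(m, n)) : frob2 (- X) = frob2 X.
Proof. by do 2![apply: eq_bigr => ? _]; rewrite mxE normrN. Qed.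

Lemma frob2D m n (X Y : 'M[C]_(m, n)) :
  frob2 (X + Y) <= (frob2 X + frob2 Y) *+ 2.
Proof.
rewrite /frob2 -big_split -sumrMnl; apply: ler_sum => i _ /=.
rewrite -big_split -sumrMnl; apply: ler_sum => j _ /=; rewrite mxE.
set x := X i j; set y := Y i j.
apply: le_trans (_ : (`|x| + `|y|) ^+ 2 <= _).
  by rewrite ler_sqr ?nnegrE ?addr_ge0 // ler_normD.
rewrite -subr_ge0 (_ : _ - _ = (`|x| - `|y|) ^+ 2); last by ring.
by apply: real_exprn_even_ge0 => //; rewrite rpredB // normr_real.
Qed.

Lemma frob2M m n k (X : 'M[C]_(m, n)) (Y : 'M[C]_(n, k)) :
  frob2 (X *m Y) <= frob2 X * frob2 Y.
Proof.
rewrite /frob2 (exchange_big _ _ _ _ _ (fun i j => `|Y i j| ^+ 2)) mulr_suml.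
apply: ler_sum => i _; rewrite mulr_sumr; apply: ler_sum => j _.
by rewrite mxE; apply: sum_CauchySchwarz.
Qed.

Lemma frob2_unitaryl m n (U : 'M[C]_m) (X : 'M[C]_(m, n)) :
  U \is unitarymx -> frob2 (U *m X) = frob2 X.
Proof.
move=> uU; rewrite !frob2E trmx_mul map_mxM mulmxA mxtrace_mulC.
rewrite -invmx_unitary // !mulmxA mulVmx ?mul1mx //.
exact: unitarymx_unit.
Qed.

Lemma frob2_unitaryr m n (U : 'M[C]_n) (X : 'M[C]_(m, n)) :
  U \is unitarymx -> frob2 (X *m U) = frob2 X.
Proof.
move=> uU; rewrite !frob2E trmx_mul map_mxM -mulmxA (mulmxA U).
by rewrite (unitarymxP uU) mul1mx.
Qed.

Lemma trace_CauchySchwarz n (X Y : 'M[C]_n) :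
  `|\tr (X *m Y)| ^+ 2 <= frob2 X * frob2 Y.
Proof.
have -> : \tr (X *m Y) = \sum_(ij : 'I_n * 'I_n) X ij.1 ij.2 * Y ij.2 ij.1.
  by rewrite -(pair_bigA _ (fun i j => X i j * Y j i)); apply: eq_bigr => i _; rewrite mxE.
apply: le_trans (sum_CauchySchwarz _ _) _.
rewrite -(pair_bigA _ (fun i j => `|X i j| ^+ 2)).
by rewrite -(pair_bigA _ (fun i j => `|Y j i| ^+ 2)) [frob2 Y]exchange_big.
Qed.

(* All c ^+ k *m b have the trace of b, so b is traceless on the orthogonal complement of the
   fixed space of c; being close to 1 there, it leaves no room for this complement. *)
Lemma unitary_commutator_eq1 n (a b c : 'M[C]_n) m :
    a \in unitmx -> c \is unitarymx -> (0 < m)%N -> c ^+ m = 1 ->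
    a *m b = c *m b *m a -> a *m c = c *m a -> frob2 (b - 1%:M) < 1 -> c = 1%:M.
Proof.
move=> ua uc m0 cm1 abc ac b1.
(* [c *m b] is the conjugate of b by a, and a commutes with the powers of c. *)
have trk k : \tr (c ^+ k *m b) = \tr b.
  elim: k => [|k IHk]; first by rewrite expr0 mul1mx.
  rewrite -IHk exprSr -mulmxA.
  have ack : a *m c ^+ k = c ^+ k *m a.
    by have := @commrX _ a c k; rewrite /GRing.comm; apply.
  have -> : c *m b = a *m b *m invmx a by rewrite abc -mulmxA mulmxV ?mulmx1.
  rewrite !mulmxA -ack mxtrace_mulC !mulmxA mulVmx // mul1mx.
  by [].
(* The average of the powers of c is the orthogonal projection onto its fixed vectors. *)
pose e := m%:R^-1 *: \sum_(k < m) c ^+ k.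
have m0C : m%:R != 0 :> C by rewrite pnatr_eq0 -lt0n.
have ce : c *m e = e.
  rewrite -scalemxAr mulmx_sumr; congr (_ *: _).
  case: m m0 cm1 {e m0C} => // m _ cm1.
  transitivity (\sum_(k < m.+1) c ^+ k.+1).
    by apply: eq_bigr => i _; rewrite exprS.
  by rewrite [LHS]big_ord_recr [RHS]big_ord_recl /= cm1 expr0 addrC.
have cke k : c ^+ k *m e = e.
  by elim: k => [|k IHk]; rewrite ?expr0 ?mul1mx // exprSr -mulmxA ce.
have sumE (z : 'M[C]_n) : m%:R^-1 *: \sum_(k < m) z = z.
  by rewrite sumr_const card_ord -scaler_nat scalerA mulVf // scale1r.
have ee : e *m e = e.
  rewrite {1}/e -scalemxAl mulmx_suml -[RHS]sumE; congr (_ *: _).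
  by apply: eq_bigr => k _.
have adjM (x y : 'M[C]_n) : (x *m y) ^t* = y ^t* *m x ^t* by rewrite trmx_mul map_mxM.
have esc : e ^t* *m c = e ^t*.
  have := congr1 (fun z => z ^t* *m c) ce; rewrite adjM -mulmxA => <-.
  by rewrite -(invmx_unitary uc) mulVmx ?mulmx1 // unitarymx_unit.
have esck k : e ^t* *m c ^+ k = e ^t*.
  by elim: k => [|k IHk]; rewrite ?expr0 ?mulmx1 // exprS mulmxA esc.
have ese : e ^t* *m e = e ^t*.
  rewrite {2}/e -scalemxAr mulmx_sumr -[RHS]sumE; congr (_ *: _).
  by apply: eq_bigr => k _.
have es : e ^t* = e by have := adjM (e ^t*) e; rewrite ese trmxCK ese.
pose f : 'M[C]_n := 1%:M - e.
have ff : f *m f = f.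
  by rewrite /f mulmxBl mul1mx mulmxBr mulmx1 ee subrr subr0.
have fs : f ^t* = f.
  by rewrite /f linearB /= map_mxB es trmx1 map_mx1.
have Nf : frob2 f = \tr f by rewrite frob2E fs ff.
have fb : \tr (f *m b) = 0.
  rewrite mulmxBl linearB /= mul1mx -scalemxAl mulmx_suml linearZ /= linear_sum /=.
  rewrite (eq_bigr (fun=> \tr b)) => [|k _]; last exact: trk.
  by rewrite sumr_const card_ord -[X in _ * X]mulr_natl mulKf // subrr.
(* The trace on the left is [- \tr f = - frob2 f], so [frob2 f <= frob2 (b - 1%:M) < 1] unless f =
   0; but a nonzero idempotent has norm at least 1. *)
have : `|\tr (f *m (b - 1%:M))| ^+ 2 <= frob2 f * frob2 (b - 1%:M).
  exact: trace_CauchySchwarz.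
rewrite mulmxBr linearB /= fb mulmx1 sub0r normrN -Nf ger0_norm ?frob2_ge0 // expr2.
have [f0 _|f0] := eqVneq (frob2 f) 0.
  have e1 : e = 1%:M by apply/esym/eqP; rewrite -subr_eq0; apply/eqP/frob2_eq0.
  by have := ce; rewrite e1 mulmx1.
have fpos : 0 < frob2 f by rewrite lt_def f0 frob2_ge0.
rewrite ler_pM2l // => le_fb.
have : frob2 f <= frob2 f * frob2 f by rewrite -{1}ff frob2M.
rewrite -{1}[frob2 f]mulr1 ler_pM2l // => le1.
by have := lt_le_trans b1 (le_trans le1 le_fb); rewrite ltxx.
Qed.

End FrobeniusNorm.

(** * Finite matrix groups as lists *)

Section MatrixFinGroup.
Variables (R : comUnitRingType) (n : nat).

(** Finiteness supplies the inverses: left multiplication by an element permutes the list. *)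
Definition mx_fingroup (L : seq 'M[R]_n) : Prop :=
  [/\ uniq L, 1%:M \in L, {in L, forall g, g \in unitmx}
    & {in L &, forall g h, g *m h \in L}].

Variable L : seq 'M[R]_n.
Hypothesis gL : mx_fingroup L.

Lemma mx_fingroup_perm g : g \in L -> perm_eq [seq g *m h | h <- L] L.
Proof.
case: gL => uL L1 LU LM Lg.
have ug : uniq [seq g *m h | h <- L].
  by rewrite map_inj_uniq // => x y; apply: can_inj (mulKmx (LU _ Lg)) _ _.
have sub : {subset [seq g *m h | h <- L] <= L}.
  by move=> _ /mapP[h Lh ->]; apply: LM.
apply: uniq_perm => //.
by have [] := uniq_min_size ug sub; rewrite ?size_map.
Qed.

Lemma mx_fingroupV g : g \in L -> invmx g \in L.
Proof.
move=> Lg; have := perm_mem (mx_fingroup_perm Lg) 1%:M.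
case: gL => _ -> LU _ /mapP[h Lh e].
by rewrite -[invmx g]mulmx1 e mulKmx // LU.
Qed.

Lemma mx_fingroupX g k : g \in L -> g ^+ k \in L.
Proof.
case: gL => _ L1 _ LM Lg; elim: k => [|k IHk]; first by rewrite expr0.
by rewrite exprS; apply: LM.
Qed.

Lemma mx_fingroup_torsion g : g \in L -> exists m, (0 < m)%N /\ g ^+ m = 1.
Proof.
move=> Lg; pose s := [seq g ^+ i | i <- iota 0 (size L).+1].
have : ~~ uniq s.
  apply/negP => us; have := uniq_leq_size us (_ : {subset s <= L}).
  rewrite size_map size_iota ltnn; suff h : {subset s <= L} by move/(_ h).
  by move=> _ /mapP[i _ ->]; apply: mx_fingroupX.
case/(uniqPn 0) => i [j [ij]]; rewrite size_map size_iota => jL.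
rewrite !(nth_map 0%N) ?size_iota ?nth_iota ?(ltn_trans ij) // !add0n => e.
exists (j - i)%N; split; first by rewrite subn_gt0.
case: gL => _ _ LU _; have Lgi := LU _ (mx_fingroupX i Lg).
apply: (can_inj (mulKmx Lgi)); rewrite -[LHS]exprD subnKC 1?ltnW // -e.
by rewrite [RHS]mulr1.
Qed.

End MatrixFinGroup.

Lemma ltn_count (T : eqType) (p q : pred T) (s : seq T) x :
  subpred p q -> x \in s -> q x -> ~~ p x -> (count p s < count q s)%N.
Proof.
move=> pq + qx /negPf px; elim: s => //= y s IHs.
rewrite inE => /predU1P[<-|/IHs lt]; first by rewrite px qx ltnS sub_count.
by rewrite -addnS leq_add //; case: (boolP (p y)) => // /pq ->.
Qed.

Section Unitary.
Variable C : numClosedFieldType.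
Local Open Scope sesquilinear_scope.

Lemma adj_mulmx m n k (x : 'M[C]_(m, n)) (y : 'M[C]_(n, k)) :
  (x *m y) ^t* = y ^t* *m x ^t*.
Proof. by rewrite trmx_mul map_mxM. Qed.

(** Averaging makes M invariant under h -> g h adj(g) and positive definite. A matrix Q with Q M
    adj(Q) = 1 then conjugates the group into the unitary group. *)
Lemma unitarizable n (L : seq 'M[C]_n) : mx_fingroup L ->
  exists Q, Q \in unitmx /\ {in L, forall g, Q *m g *m invmx Q \is unitarymx}.
Proof.
move=> gL; pose M := \sum_(h <- L) h *m h ^t*.
have MU g : g \in L -> g *m M *m g ^t* = M.
  move=> Lg; rewrite mulmx_sumr mulmx_suml.
  rewrite -[RHS](perm_big _ (mx_fingroup_perm gL Lg)) big_map.
  by apply: eq_bigr => h _; rewrite adj_mulmx !mulmxA.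
have Mh : M ^t* = M.
  rewrite /M linear_sum map_mx_sum; apply: eq_bigr => h _.
  by rewrite [LHS]adj_mulmx trmxCK.
have nM : M \is normalmx by apply/normalmxP; rewrite Mh.
have Me := orthomx_spectralP nM.
set P := spectralmx M in Me; set sp := spectral_diag M in Me.
have uP : P \is unitarymx by apply: spectral_unitarymx.
have Pu := unitarymx_unit uP.
have PMP : P *m M *m P ^t* = diag_mx sp.
  by rewrite Me -(invmx_unitary uP) !mulmxA mulmxV // mul1mx mulmxK.
case: (gL) => uL L1 LU _.
have sp_gt0 i : 0 < sp 0 i.
  have -> : sp 0 i = (P *m M *m P ^t*) i i by rewrite PMP mxE eqxx mulr1n.
  (* The summand of the identity contributes exactly 1 to the eigenvalue, the others are sums of
     squared moduli. *)
  rewrite /M mulmx_sumr mulmx_suml summxE (big_rem 1%:M) //=.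
  apply: ltr_wpDr.
    apply: sumr_ge0 => h _; rewrite mulmxA -mulmxA -adj_mulmx mxE.
    by apply: sumr_ge0 => j _; rewrite !mxE -normCK exprn_ge0.
  by rewrite trmx1 map_mx1 !mulmx1 (unitarymxP uP) mxE eqxx ltr01.
pose D := diag_mx (\row_i (sqrtC (sp 0 i))^-1).
have Dh : D ^t* = D.
  rewrite tr_diag_mx map_diag_mx; congr diag_mx; apply/rowP => i; rewrite !mxE.
  by apply: conj_Creal; rewrite realE invr_ge0 sqrtC_ge0 ltW.
have DD : D *m diag_mx sp *m D = 1%:M.
  rewrite !mulmx_diag; apply/matrixP => i j; rewrite !mxE; case: eqP => // _.
  have s0 : sqrtC (sp 0 i) != 0 by rewrite sqrtC_eq0 gt_eqF.
  by rewrite -{2}[sp 0 i]sqrtCK expr2 mulrA mulVf // mul1r mulfV.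
have uD : D \in unitmx.
  rewrite unitmxE unitfE det_diag; apply/prodf_neq0 => i _; rewrite mxE.
  by rewrite invr_eq0 sqrtC_eq0 gt_eqF.
pose Q := D *m P.
have uQ : Q \in unitmx by rewrite unitmx_mul uD.
have QMQ : Q *m M *m Q ^t* = 1%:M.
  by rewrite adj_mulmx Dh !mulmxA -(mulmxA D) -(mulmxA D) PMP.
exists Q; split=> // g Lg; apply/unitarymxP.
have EM : M = invmx Q *m (invmx Q) ^t*.
  have us : Q ^t* \in unitmx by rewrite map_unitmx unitmx_tr.
  rewrite -[M](mulKmx uQ) -[Q *m M](mulmxK us) QMQ mul1mx; congr (_ *m _).
  apply: (can_inj (mulmxK us)); rewrite mulVmx // -adj_mulmx mulmxV //.
  by rewrite trmx1 map_mx1.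
rewrite !adj_mulmx mulmxA -(mulmxA (Q *m g)) -EM mulmxA.
by rewrite -(mulmxA Q g) -(mulmxA Q (g *m M)) MU // -adj_mulmx.
Qed.

(** By unitary invariance the left side is the norm of ab - ba = (a-1)(b-1) - (b-1)(a-1). Of the
    factor 4, one 2 comes from [frob2D] and the other from the two equally bounded products. *)
Lemma commutator_small n (a b : 'M[C]_n) :
    a \is unitarymx -> b \is unitarymx ->
  frob2 (a *m b *m invmx a *m invmx b - 1%:M)
    <= frob2 (a - 1%:M) * frob2 (b - 1%:M) *+ 4.
Proof.
move=> ua ub; have Ua := unitarymx_unit ua; have Ub := unitarymx_unit ub.
have -> : frob2 (a *m b *m invmx a *m invmx b - 1%:M) = frob2 (a *m b - b *m a).
  rewrite -(frob2_unitaryr _ (mul_unitarymx ub ua)) mulmxBl mul1mx !mulmxA.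
  by rewrite mulmxKV // mulmxKV.
have -> : a *m b - b *m a = (a - 1%:M) *m (b - 1%:M) + - ((b - 1%:M) *m (a - 1%:M)).
  rewrite !mulmxBl !mulmxBr !mul1mx !mulmx1.
  set x := a *m b; set y := b *m a; clearbody x y.
  by apply/matrixP => i j; rewrite !mxE; ring.
apply: le_trans (frob2D _ _) _; rewrite frob2N (_ : 4 = 2 * 2)%N // mulrnA.
rewrite lerMn2r /= mulr2n; apply: lerD; first exact: frob2M.
by rewrite mulrC; apply: frob2M.
Qed.

(** Below 1/4 the commutator c of a and b is strictly closer to 1 than b. Descent on the number of
    elements of L closer to 1 than b makes a commute with c, and then the trace argument of
    [unitary_commutator_eq1] gives c = 1. *)
Lemma small_unitary_comm n (L : seq 'M[C]_n) (a b : 'M[C]_n) :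
    mx_fingroup L -> {in L, forall g, g \is unitarymx} ->
    a \in L -> b \in L ->
    frob2 (a - 1%:M) < 4^-1 -> frob2 (b - 1%:M) < 4^-1 ->
  a *m b = b *m a.
Proof.
move=> gL uL La + a4; case: (gL) => _ _ LU LM.
pose less (x : C) := count (fun c => frob2 (c - 1%:M) < x) L.
have [k] := ubnP (less (frob2 (b - 1%:M))); elim: k b => // k IHk b lek Lb b4.
have [->|b1] := eqVneq b 1%:M; first by rewrite mulmx1 mul1mx.
pose c := a *m b *m invmx a *m invmx b.
have Lc : c \in L by rewrite !LM // mx_fingroupV.
have bpos : 0 < frob2 (b - 1%:M).
  rewrite lt_def frob2_ge0 andbT; apply: contraNneq b1 => /frob2_eq0 /eqP.
  by rewrite subr_eq0.
have cb : frob2 (c - 1%:M) < frob2 (b - 1%:M).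
  apply: le_lt_trans (commutator_small (uL _ La) (uL _ Lb)) _.
  rewrite -mulrnAl gtr_pMl // -mulr_natl mulrC -ltr_pdivlMr ?ltr0n // mul1r.
  by [].
have less_cb : (less (frob2 (c - 1%:M)) < less (frob2 (b - 1%:M)))%N.
  by apply: (ltn_count _ Lc); rewrite ?ltxx // => d /= /lt_trans; apply.
have ac : a *m c = c *m a.
  apply: (IHk c) => //; last exact: lt_trans cb b4.
  by apply: leq_trans less_cb _; rewrite -ltnS.
have [m [m0 cm]] := mx_fingroup_torsion gL Lc.
have cab : a *m b = c *m b *m a.
  by rewrite /c !mulmxKV // LU.
have c1 : c = 1%:M.
  apply: (unitary_commutator_eq1 (LU _ La) (uL _ Lc) m0 cm cab ac).
  by apply: lt_trans b4 _; rewrite invf_lt1 ?ltr1n ?ltr0n.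
by rewrite cab c1 mul1mx.
Qed.
End Unitary.

(** * Pigeonhole principle for unitary matrices *)

Section Box.
Local Open Scope sesquilinear_scope.

(** Index of x in the grid of mesh 1/m on the interval from -1 to 1. The right endpoint has index
    2m, whence [(2 * m).+1] cells. *)
Definition cell (m : nat) (x : algC) : nat := Num.truncn ((x + 1) * m%:R).

Lemma cell_bound m (x : algC) : x \is Num.real -> x ^+ 2 <= 1 ->
  0 <= (x + 1) * m%:R <= (2 * m)%:R.
Proof.
move=> xr x1; have : `|x| <= 1.
  by rewrite -(ler_pXn2r (n := 2)) ?nnegrE // expr1n real_normK.
rewrite real_ler_norml // => /andP[le1 le2]; apply/andP; split.
  by rewrite mulr_ge0 ?ler0n // -[1]opprK subr_ge0.
by rewrite natrM ler_wpM2r ?ler0n // (_ : 2 = 1 + 1) ?lerD2r // -natrD.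
Qed.

Lemma cell_lt m (x : algC) : x \is Num.real -> x ^+ 2 <= 1 ->
  (cell m x < (2 * m).+1)%N.
Proof.
move=> xr x1; have /andP[h1 h2] := cell_bound m xr x1.
have /andP[h3 _] := truncn_itv h1.
by rewrite ltnS -(ler_nat algC) (le_trans h3).
Qed.

Lemma cell_eq m (x y : algC) : (0 < m)%N ->
    x \is Num.real -> y \is Num.real -> x ^+ 2 <= 1 -> y ^+ 2 <= 1 ->
  cell m x = cell m y -> (x - y) ^+ 2 <= m%:R^-2.
Proof.
move=> m0 xr yr x1 y1 exy.
have /andP[hx _] := cell_bound m xr x1; have /andP[hy _] := cell_bound m yr y1.
have := truncn_itv hx; have := truncn_itv hy; rewrite -/(cell m x) -/(cell m y) exy.
set k := cell m y => /andP[y_ge y_lt] /andP[x_ge x_lt].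
have mC : 0 < m%:R :> algC by rewrite ltr0n.
have d : `|(x - y) * m%:R| <= 1.
  have -> : (x - y) * m%:R = (x + 1) * m%:R - (y + 1) * m%:R by ring.
  rewrite real_ler_norml; last by rewrite rpredB ?rpredM ?rpredD ?rpred1 ?rpred_nat.
  have k1 : k.+1%:R = k%:R + 1 :> algC by rewrite -natr1.
  apply/andP; split.
    rewrite lerBrDr addrC -lerBrDr opprK; apply: le_trans (ltW y_lt) _.
    by rewrite k1 lerD2r.
  rewrite lerBlDr; apply: le_trans (ltW x_lt) _.
  by rewrite k1 addrC lerD2l.
rewrite -real_normK ?rpredB // -exprVn lerXn2r ?nnegrE ?invr_ge0 ?ler0n //.
rewrite -[leRHS]mul1r ler_pdivlMr //.
by rewrite -[m%:R]ger0_norm ?ler0n // -normrM.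
Qed.

Lemma unitary_entry n (g : 'M[algC]_n) i j : g \is unitarymx -> `|g i j| ^+ 2 <= 1.
Proof.
move=> /unitarymxP /matrixP /(_ i i); rewrite !mxE eqxx mulr1n (bigD1 j) //= => e.
rewrite -[leRHS]e.
rewrite !mxE -normCK lerDl; apply: sumr_ge0 => k _.
by rewrite !mxE -normCK exprn_ge0.
Qed.

Lemma unitary_entry_ReIm n (g : 'M[algC]_n) i j : g \is unitarymx ->
  'Re (g i j) ^+ 2 <= 1 /\ 'Im (g i j) ^+ 2 <= 1.
Proof.
move/(unitary_entry i j); rewrite normC2_Re_Im => le1.
by split; apply: le_trans le1; rewrite ?lerDl ?lerDr real_exprn_even_ge0 ?Creal_Re ?Creal_Im.
Qed.

Lemma unitary_box n : exists J, forall g : 'I_J.+1 -> 'M[algC]_n,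
  (forall i, g i \is unitarymx) ->
  exists i j, i != j /\ frob2 (g i - g j) < 4^-1.
Proof.
(* Two matrices in the same box have squared distance at most 2n^2/m^2, which is below 1/4 because
   8n^2 < (3n+1)^2. *)
pose m := (3 * n).+1.
pose T := {ffun 'I_n * 'I_n -> 'I_(2 * m).+1 * 'I_(2 * m).+1}.
exists #|{: T}| => g ug.
pose f (i : 'I_(#|{: T}|.+1)) : T := [ffun ab =>
  (inord (cell m ('Re (g i ab.1 ab.2))), inord (cell m ('Im (g i ab.1 ab.2))))].
have : ~ injective f.
  by move=> /leq_card; rewrite card_ord ltnn.
move=> ninj; have [i [j [ij fij]]] : exists i j, i != j /\ f i = f j.
  have /injectivePn[i [j ij fij]] : ~~ injectiveb f by apply/injectiveP.
  by exists i, j.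
exists i, j; split=> //.
have le_ab a b : `|(g i - g j) a b| ^+ 2 <= m%:R^-2 *+ 2.
  have [ri ii] := unitary_entry_ReIm a b (ug i).
  have [rj ij'] := unitary_entry_ReIm a b (ug j).
  have := congr1 (fun h : T => h (a, b)) fij; rewrite !ffunE /= => -[].
  move=> /(congr1 val) /= e1 /(congr1 val) /= e2.
  rewrite !inordK ?cell_lt ?Creal_Re ?Creal_Im // in e1 e2.
  rewrite !mxE normC2_Re_Im raddfB [X in _ + X ^+ 2]raddfB mulr2n.
  by apply: lerD; apply: cell_eq; rewrite ?Creal_Re ?Creal_Im.
apply: le_lt_trans (_ : (m%:R^-2 *+ 2) *+ (n * n) < _).
  rewrite mulrnA -[X in _ *+ X]card_ord -sumr_const; apply: ler_sum => a _.
  rewrite -[X in _ *+ X]card_ord -sumr_const; apply: ler_sum => b _.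
  exact: le_ab.
rewrite -mulrnA -[_ *+ _]mulr_natl -exprVn exprVn ltr_pdivrMr ?exprn_gt0 ?ltr0n //.
rewrite mulrC ltr_pdivlMr ?ltr0n // -natrX -natrM ltr_nat /m.
by rewrite -mulnn; nia.
Qed.

End Box.

(** * The Jordan-Schur theorem *)

(* S stands for the elements close to 1: they generate an abelian normal subgroup, and
   J.+1 elements cannot lie in distinct cosets of it. *)
Definition jordan_set (F : fieldType) n (G : 'M[F]_n -> Prop) (J : nat)
    (S : 'M[F]_n -> Prop) : Prop :=
  [/\ forall x, S x -> G x,
      forall x y, S x -> S y -> x *m y = y *m x,
      forall x y, G x -> S y -> S (x *m y *m invmx x),
      forall x, S x -> S (invmx x)
    & forall c : 'I_J.+1 -> 'M[F]_n, (forall i, G (c i)) ->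
        exists i j, i != j /\ S (invmx (c i) *m c j)].

(** J is fixed before the field and the group; this uniformity is what the passage to locally finite
    groups uses. *)
Lemma jordan_finite n : exists J, forall (F : fieldType) (L : seq 'M[F]_n),
  [pchar F] =i pred0 -> mx_fingroup L ->
  exists S, jordan_set (fun x => x \in L) J S.
Proof.
have [J box] := unitary_box n; exists J => F L charF gL.
pose ent := [seq (h : 'M[F]_n) ij.1 ij.2 | h <- L, ij <- enum {: 'I_n * 'I_n}].
(* Injectivity on the entries makes [r] a faithful representation over [algC]; 0 is listed to put it
   in the domain D. *)
have [D [rho [[D1 rho1] Dent DD DM rho_inj]]] :=
  specialization_inj algC (0 :: ent) charF.
have D0 : D 0 by apply: Dent; rewrite mem_head.
have rho0 : rho 0 = 0.
  by have [_ /eqP] := DD _ _ D0 D0; rewrite addr0 -subr_eq subrr => /eqP.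
have ent_in (h : 'M[F]_n) i j : h \in L -> h i j \in ent.
  by move=> Lh; apply/allpairsP; exists (h, (i, j)); rewrite mem_enum.
have DL (h : 'M[F]_n) i j : h \in L -> D (h i j).
  by move=> Lh; apply: Dent; rewrite inE ent_in ?orbT.
have rho_sum (I : Type) (s : seq I) (f : I -> F) : (forall i, D (f i)) ->
    D (\sum_(i <- s) f i) /\ rho (\sum_(i <- s) f i) = \sum_(i <- s) rho (f i).
  move=> Df; elim: s => [|i s [IH1 IH2]]; first by rewrite !big_nil.
  by rewrite !big_cons -IH2; apply: DD.
pose r (h : 'M[F]_n) := map_mx rho h.
have rM g h : g \in L -> h \in L -> r (g *m h) = r g *m r h.
  move=> Lg Lh; apply/matrixP => i j; rewrite !mxE.
  have Dk k : D (g i k * h k j) by have [] := DM _ _ (DL g i k Lg) (DL h k j Lh).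
  rewrite (rho_sum _ _ _ Dk).2; apply: eq_bigr => k _; rewrite !mxE.
  by have [] := DM _ _ (DL g i k Lg) (DL h k j Lh).
have r1 : r 1%:M = 1%:M.
  by apply/matrixP => i j; rewrite !mxE; case: eqP => _; rewrite ?mulr1n ?mulr0n.
have r_inj : {in L &, injective r}.
  move=> g h Lg Lh /matrixP e; apply/matrixP => i j.
  by have := e i j; rewrite !mxE => /rho_inj; apply; rewrite inE ent_in ?orbT.
case: (gL) => uL L1 LU LM.
have rV g : g \in L -> r g \in unitmx /\ r (invmx g) = invmx (r g).
  move=> Lg; have Lg' := mx_fingroupV gL Lg.
  have e : r g *m r (invmx g) = 1%:M by rewrite -rM // mulmxV ?LU.
  have [ur _] := mulmx1_unit e; split=> //.
  by rewrite -[LHS](mulKmx ur) e mulmx1.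
pose L' := [seq r g | g <- L].
have gL' : mx_fingroup L'.
  split.
  - by rewrite map_inj_in_uniq.
  - by apply/mapP; exists 1%:M; rewrite ?r1.
  - by move=> _ /mapP[g Lg ->]; case: (rV g Lg).
  - move=> _ _ /mapP[g Lg ->] /mapP[h Lh ->]; rewrite -rM //.
    by apply: map_f; apply: LM.
have [Q [uQ unitQ]] := unitarizable gL'.
pose t g := Q *m r g *m invmx Q.
have tM g h : g \in L -> h \in L -> t (g *m h) = t g *m t h.
  by move=> Lg Lh; rewrite /t rM // !mulmxA mulmxKV.
have t1 : t 1%:M = 1%:M by rewrite /t r1 mulmx1 mulmxV.
have tV g : g \in L -> t (invmx g) = invmx (t g).
  move=> Lg; have e : t g *m t (invmx g) = 1%:M.
    by rewrite -tM ?mulmxV ?LU // mx_fingroupV.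
  by have [ut _] := mulmx1_unit e; rewrite -[LHS](mulKmx ut) e mulmx1.
have tu g : g \in L -> t g \is unitarymx.
  by move=> Lg; apply: unitQ; apply: map_f.
have t_inj : {in L &, injective t}.
  move=> g h Lg Lh e; apply: r_inj => //.
  apply: (can_inj (mulKmx uQ)); apply: (can_inj (mulmxK (_ : invmx Q \in unitmx))) => //.
  by rewrite unitmx_inv.
have gT : mx_fingroup [seq t g | g <- L].
  split.
  - by rewrite map_inj_in_uniq.
  - by apply/mapP; exists 1%:M; rewrite ?t1.
  - by move=> _ /mapP[g Lg ->]; apply/unitarymx_unit/tu.
  - move=> _ _ /mapP[g Lg ->] /mapP[h Lh ->]; rewrite -tM //.
    by apply: map_f; apply: LM.
exists (fun g => g \in L /\ frob2 (t g - 1%:M) < 4^-1); split.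
- by move=> x [].
- move=> x y [Lx x4] [Ly y4]; apply: t_inj; rewrite ?LM // !tM //.
  apply: (small_unitary_comm gT) => //; try exact: map_f.
  by move=> _ /mapP[g Lg ->]; apply: tu.
- move=> x y Lx [Ly y4]; have Lx' := mx_fingroupV gL Lx; split; first by rewrite !LM.
  rewrite !tM ?LM // tV //.
  have ux := unitarymx_unit (tu _ Lx).
  have -> : t x *m t y *m invmx (t x) - 1%:M = t x *m (t y - 1%:M) *m invmx (t x).
    by rewrite mulmxBr mulmxBl mulmx1 mulmxV.
  by rewrite frob2_unitaryr ?frob2_unitaryl ?tu // -tV ?tu.
- move=> x [Lx x4]; have Lx' := mx_fingroupV gL Lx; split=> //.
  rewrite -(frob2_unitaryl _ (tu _ Lx)) mulmxBr -tM // mulmxV ?LU // t1 mulmx1.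
  by rewrite -frob2N opprB.
- move=> c Lc; have [i [j [ij lt]]] := box (fun i => t (c i)) (fun i => tu _ (Lc i)).
  have Lci := mx_fingroupV gL (Lc i).
  exists i, j; split=> //; split; first exact: LM.
  rewrite -(frob2_unitaryl _ (tu _ (Lc i))) mulmxBr -tM ?LM // mulKVmx ?LU //.
  by rewrite mulmx1 -frob2N opprB.
Qed.

(* The sets of small elements of the finite subgroups depend on the chosen specialisations;
   an ultrafilter on the finite subgroups makes them coherent. *)
Theorem jordan_schur (F : fieldType) n (G : 'M[F]_n -> Prop) :
    [pchar F] =i pred0 ->
    (forall s : seq 'M[F]_n, (forall x, x \in s -> G x) ->
      exists L, [/\ mx_fingroup L, {subset s <= L} & forall x, x \in L -> G x]) ->
  exists J S, jordan_set G J S.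
Proof.
move=> charF locfin; have [J jord] := jordan_finite n.
pose S_ (L : seq 'M[F]_n) := epsilon (inhabits (fun _ : 'M[F]_n => False))
  (fun S => jordan_set (fun x => x \in L) J S).
have S_P L : mx_fingroup L -> jordan_set (fun x => x \in L) J (S_ L).
  by move=> gL; apply: epsilon_spec; apply: jord.
pose above (s L : seq 'M[F]_n) := [/\ mx_fingroup L, {subset s <= L} & forall x, x \in L -> G x].
(* The filter base consists of the cones of finite subgroups of G above a given finite subset,
   nonempty by local finiteness. *)
pose B (U : seq 'M[F]_n -> Prop) :=
  exists s, (forall x, x \in s -> G x) /\ forall L, above s L -> U L.
have BP : @filter.ProperFilter (seq 'M[F]_n) B.
  split; first by case=> s [/locfin[L aL] /(_ L aL)].
  split; first by exists [::]; split.
    move=> U V [s [Gs sU]] [s' [Gs' sV]]; exists (s ++ s'); split.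
      by move=> x; rewrite mem_cat => /orP[/Gs|/Gs'].
    move=> L [gL ssL GL]; split; [apply: sU | apply: sV]; split=> // x xs;
      by apply: ssL; rewrite mem_cat xs ?orbT.
  by move=> U V UV [s [Gs sU]]; exists s; split=> // L /sU/UV.
have [W [Wult BW]] := filter.ultraFilterLemma BP.
have Wprop := @filter.ultra_proper _ _ Wult.
have WI U V : W U -> W V -> W (fun L => U L /\ V L).
  exact: (@filter.filterI _ _ (@filter.filter_filter _ _ Wprop)).
have WS (U V : seq 'M[F]_n -> Prop) : (forall L, U L -> V L) -> W U -> W V.
  exact: (@filter.filterS _ _ (@filter.filter_filter _ _ Wprop)).
have Wex U : W U -> exists L, U L.
  move=> WU; have [//|nU] := classic (exists L, U L).
  case: (@filter.filter_not_empty _ _ Wprop); apply: WS WU => L UL.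
  by case: nU; exists L.
have Wor U : W U \/ W (fun L => ~ U L) by apply: filter.in_ultra_setVsetC.
have Wabove s : (forall x, x \in s -> G x) -> W (above s).
  by move=> Gs; apply: BW; exists s.
have Wall (I : eqType) (s : seq I) (U : I -> seq 'M[F]_n -> Prop) :
    (forall i, i \in s -> W (U i)) -> W (fun L => forall i, i \in s -> U i L).
  elim: s => [|i s IH] WU; first by apply: WS (Wabove [::] _) => // L _ i.
  have /WI/(_ (IH _)) : W (U i) by apply: WU; rewrite mem_head.
  move=> h; apply: WS (h _) => [L [Ui Us] j|j js]; last by apply: WU; rewrite inE js orbT.
  by rewrite inE => /predU1P[->|/Us].
have above1 x L : above [:: x] L -> x \in L by case=> _ + _; apply; rewrite mem_head.
have Wabove1 x : G x -> W (above [:: x]).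
  by move=> Gx; apply: Wabove => y; rewrite inE => /eqP->.
exists J, (fun x => W (fun L => above [::] L /\ S_ L x)); split.
- by move=> x /Wex[L [[gL _ GL] Sx]]; apply: GL; have [h _ _ _ _] := S_P L gL; apply: h.
- move=> x y Wx Wy; have /Wex[L [[[gL _ GL] Sx] [_ Sy]]] := WI _ _ Wx Wy.
  by have [_ h _ _ _] := S_P L gL; apply: h.
- move=> x y Gx Wy; apply: WS (WI _ _ (Wabove1 x Gx) Wy) => L [aL [a0 Sy]].
  split=> //; case: a0 => gL _ _; have [_ _ h _ _] := S_P L gL.
  by apply: h => //; apply: above1.
- move=> x Wx; apply: WS Wx => L [a0 Sx]; split=> //; case: a0 => gL _ _.
  by have [_ _ _ h _] := S_P L gL; apply: h.
(* If every pair failed, the ultrafilter would contain the failure of each, hence of all of the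
   finitely many pairs at once. Some finite subgroup containing all [c i] would then violate the
   finite case. *)
- move=> c Gc; apply: NNPP => nS.
  pose bad (ij : 'I_J.+1 * 'I_J.+1) L :=
    ~ (above [::] L /\ S_ L (invmx (c ij.1) *m c ij.2)).
  have Wbad ij : ij \in [seq ij <- enum {: 'I_J.+1 * 'I_J.+1} | ij.1 != ij.2] -> W (bad ij).
    rewrite mem_filter => /andP[nij _].
    have [h|//] := Wor (fun L => above [::] L /\ S_ L (invmx (c ij.1) *m c ij.2)).
    by case: nS; exists ij.1, ij.2.
  have Wc : W (above (codom c)) by apply: Wabove => _ /codomP[i ->].
  have /Wex[L [[gL cL GL] badL]] := WI _ _ Wc (Wall _ _ _ Wbad).
  have [_ _ _ _ h] := S_P L gL.
  have [i [j [ij Sij]]] := h c (fun i => cL _ (codom_f c i)).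
  apply: (badL (i, j)); first by rewrite mem_filter ij mem_enum.
  by split.
Qed.

(** * Simultaneous diagonalization of commuting torsion matrices *)

Section Codiagonalize.
Variables (F : closedFieldType) (n : nat).
Hypothesis charF : [pchar F] =i pred0.

Lemma torsion_diagonalizable (A : 'M[F]_n) m :
  (0 < m)%N -> A ^+ m = 1 -> diagonalizable A.
Proof.
case: n A => [|n'] A m0 Am.
  by exists 1%:M; rewrite ?unitmx1 //; apply/diagonalizable_forP => [|[]]; rewrite ?unitmx1.
apply/diagonalizableP.
have [rs Xrs] := closed_field_poly_normal ('X^m - 1 : {poly F}).
have lc : lead_coef ('X^m - 1 : {poly F}) = 1 by apply/eqP; exact: monicXnsubC.
rewrite lc scale1r in Xrs.
exists rs; last first.
  rewrite -Xrs; apply: mxminpoly_min.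
  by rewrite rmorphB rmorphXn /= horner_mx_X rmorph1 Am subrr.
rewrite -separable_prod_XsubC -Xrs; apply: separable_Xn_sub_1.
by move/pcharf0P: charF => ->; rewrite -lt0n.
Qed.

(** A may be infinite, but a finite subset with span of maximal dimension spans all of A, and a
    basis diagonalizing that subset diagonalizes its span. *)
Lemma torsion_codiagonalizable (A : 'M[F]_n -> Prop) :
    (forall x y, A x -> A y -> x *m y = y *m x) ->
    (forall x, A x -> exists m, (0 < m)%N /\ x ^+ m = 1) ->
  exists P : 'M[F]_n, P \in unitmx /\
    forall x, A x -> is_diag_mx (invmx P *m x *m P).
Proof.
move=> Acomm Ators.
have [|s [As max_s]] := @ex_minimal (seq 'M[F]_n) (fun s => forall x, x \in s -> A x)
  (fun s => \dim {: 'M[F]_n} - \dim <<s>>)%N.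
  by exists [::].
have span x : A x -> x \in <<s>>%VS.
  move=> Ax; have As' y : y \in x :: s -> A y.
    by rewrite inE => /predU1P[->|/As].
  have := max_s _ As'.
  have sub : (<<s>> <= <<x :: s>>)%VS by apply: sub_span => y ys; rewrite inE ys orbT.
  have le1 := dimvS sub; have le2 := dimvS (subvf <<x :: s>>).
  move=> /= le; have eq : \dim <<s>> = \dim <<x :: s>>.
    move: (\dim <<s>>) (\dim <<x :: s>>) (\dim _) le le1 le2 => a b c.
    by lia.
  have /eqP-> : (<<s>> == <<x :: s>>)%VS by rewrite eqEdim sub eq leqnn.
  by rewrite memv_span // mem_head.
have [P Pu Ps] : codiagonalizable s.
  apply/codiagonalizableP; split.
    by move=> x y /As Ax /As Ay; apply: Acomm.
  by move=> x /As/Ators[m [m0 xm]]; apply: torsion_diagonalizable m0 xm.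
exists (invmx P); rewrite unitmx_inv; split=> // x /span xs; rewrite invmxK.
apply/is_diag_mxP => i j ij.
rewrite (coord_span (X := in_tuple s) xs) mulmx_sumr mulmx_suml summxE big1 // => k _.
rewrite -scalemxAr -scalemxAl mxE.
have sk : (in_tuple s)`_k \in s by apply: mem_nth; case: k.
have /allP/(_ _ sk)/diagonalizable_forP := Ps.
by move=> /(_ Pu) ->; rewrite ?mulr0.
Qed.

End Codiagonalize.

(** * Residual rigidity and local finiteness *)

Section MaximalFamily.
Variables (T : eqType) (r : T -> T -> Prop) (P : T -> Prop).

(** Used with three relations: equality, congruence modulo p, and differing by a small group
    element. *)
Fixpoint rfree (s : seq T) : Prop :=
  if s is x :: s' then (forall y, y \in s' -> ~ r x y) /\ rfree s' else True.

Lemma rfree_maximal N :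
    (forall s, rfree s -> (forall x, x \in s -> P x) -> (size s <= N)%N) ->
  exists s, [/\ rfree s, forall x, x \in s -> P x
    & forall x, P x -> exists y, y \in s /\ r x y].
Proof.
move=> bnd.
have [|s [[fs sP] max_s]] := @ex_minimal (seq T)
  (fun s => rfree s /\ forall x, x \in s -> P x) (fun s => N - size s)%N.
  by exists [::].
exists s; split=> // x Px; apply: NNPP => nx.
have fxs : rfree (x :: s) by split=> // y ys rxy; apply: nx; exists y.
have xsP y : y \in x :: s -> P y by rewrite inE => /predU1P[->|/sP].
have /= := max_s _ (conj fxs xsP); have /= := bnd _ fxs xsP; lia.
Qed.

Lemma rfree_nth x0 s i j : rfree s -> (i < j < size s)%N ->
  ~ r (nth x0 s i) (nth x0 s j).
Proof.
elim: s i j => [|x s IHs] i j /=; first by rewrite ltn0 andbF.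
case: j => [|j]; first by rewrite ltn0.
case: i => [|i] /= [h fs] => [js|ijs]; last exact: IHs.
by apply: h; apply: mem_nth.
Qed.

End MaximalFamily.

Lemma rfree_eq (T : eqType) (s : seq T) : rfree (fun x y => x = y) s <-> uniq s.
Proof.
elim: s => //= x s IHs; split.
  by case=> xs /IHs ->; rewrite andbT; apply/negP => /xs.
case/andP => /negP xs /IHs fs; split=> // y ys xy; apply: xs.
by rewrite xy.
Qed.

Lemma finite_enum (T : eqType) (P : T -> Prop) N :
    (forall s, uniq s -> (forall x, x \in s -> P x) -> (size s <= N)%N) ->
  exists s, uniq s /\ forall x, x \in s <-> P x.
Proof.
move=> bnd; have [|s [/rfree_eq us sP Ps]] := @rfree_maximal _ (fun x y => x = y) P N.
  by move=> s /rfree_eq; apply: bnd.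
by exists s; split=> // x; split=> [/sP|/Ps[y [ys ->]]].
Qed.

(** * Congruences modulo powers of p *)

Section PDivisibility.
Variables (p : nat) (R : idomainType) (phi : {rmorphism R -> R}).
Hypotheses (p_prime : prime p) (HR : Witt_Fpbar R p) (Hphi : Frob_lift p phi).

Local Notation pR := (p%:R : R).

Lemma pR_neq0 : pR != 0.
Proof. by case: HR. Qed.

Lemma pX_neq0 k : pR ^+ k != 0.
Proof. by rewrite expf_neq0 // pR_neq0. Qed.

Lemma pdvd0 k : pdvd p k (0 : R).
Proof. by exists 0; rewrite mulr0. Qed.

Lemma pdvdD k (x y : R) : pdvd p k x -> pdvd p k y -> pdvd p k (x + y).
Proof. by case=> a -> [b ->]; exists (a + b); rewrite mulrDr. Qed.

Lemma pdvdN k (x : R) : pdvd p k x -> pdvd p k (- x).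
Proof. by case=> a ->; exists (- a); rewrite mulrN. Qed.

Lemma pdvdB k (x y : R) : pdvd p k x -> pdvd p k y -> pdvd p k (x - y).
Proof. by move=> hx hy; apply: pdvdD => //; apply: pdvdN. Qed.

Lemma pdvdMr k (x y : R) : pdvd p k x -> pdvd p k (x * y).
Proof. by case=> a ->; exists (a * y); rewrite mulrA. Qed.

Lemma pdvdMl k (x y : R) : pdvd p k y -> pdvd p k (x * y).
Proof. by rewrite mulrC; apply: pdvdMr. Qed.

Lemma pdvd_leq k l (x : R) : (l <= k)%N -> pdvd p k x -> pdvd p l x.
Proof.
by move=> lk [a ->]; exists (pR ^+ (k - l) * a); rewrite mulrA -exprD subnKC.
Qed.

Lemma pdvd_sym k (x y : R) : pdvd p k (x - y) -> pdvd p k (y - x).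
Proof. by move/pdvdN; rewrite opprB. Qed.

Lemma pdvd_trans k (x y z : R) :
  pdvd p k (x - y) -> pdvd p k (y - z) -> pdvd p k (x - z).
Proof. by move=> h1 h2; have := pdvdD h1 h2; rewrite addrA subrK. Qed.

Lemma congD k (x y z t : R) :
  pdvd p k (x - y) -> pdvd p k (z - t) -> pdvd p k (x + z - (y + t)).
Proof. by move=> h1 h2; rewrite opprD addrACA; apply: pdvdD. Qed.

Lemma congB k (x y z t : R) :
  pdvd p k (x - y) -> pdvd p k (z - t) -> pdvd p k (x - z - (y - t)).
Proof. by move=> h1 /pdvdN; rewrite opprD => h2; apply: congD. Qed.

Lemma congM k (x y z t : R) :
  pdvd p k (x - y) -> pdvd p k (z - t) -> pdvd p k (x * z - y * t).
Proof.
move=> h1 h2; have -> : x * z - y * t = (x - y) * z + y * (z - t) by ring.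
by apply: pdvdD; [apply: pdvdMr | apply: pdvdMl].
Qed.

Lemma cong_refl k (x : R) : pdvd p k (x - x).
Proof. by rewrite subrr; apply: pdvd0. Qed.

Lemma congX k m (x y : R) : pdvd p k (x - y) -> pdvd p k (x ^+ m - y ^+ m).
Proof.
move=> h; elim: m => [|m IHm]; first by rewrite !expr0; apply: cong_refl.
by rewrite !exprS; apply: congM.
Qed.

Lemma cong_sum k (I : Type) (s : seq I) (f g : I -> R) :
  (forall i, pdvd p k (f i - g i)) -> pdvd p k (\sum_(i <- s) f i - \sum_(i <- s) g i).
Proof.
move=> h; apply: (big_ind2 (fun a b => pdvd p k (a - b))) => //.
  exact: cong_refl.
by move=> *; apply: congD.
Qed.

Lemma cong_prod k (I : Type) (s : seq I) (f g : I -> R) :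
  (forall i, pdvd p k (f i - g i)) -> pdvd p k (\prod_(i <- s) f i - \prod_(i <- s) g i).
Proof.
move=> h; apply: (big_ind2 (fun a b => pdvd p k (a - b))) => //.
  exact: cong_refl.
by move=> *; apply: congM.
Qed.

Lemma unit_not_pdvd (x : R) : x \is a GRing.unit -> ~ pdvd p 1 x.
Proof.
move=> ux [y xy]; case: HR => _ [+ _ _ _ _]; case/negP.
by move: ux; rewrite xy expr1 unitrM => /andP[].
Qed.

Lemma not_pdvd_unit (x : R) : ~ pdvd p 1 x -> x \is a GRing.unit.
Proof.
move=> nx; have x0 : x != 0 by apply/eqP => x0; apply: nx; rewrite x0; apply: pdvd0.
case: HR => _ [_ /(_ x x0)[[|k] [v [uv xv]]] _ _ _]; first by rewrite xv expr0 mul1r.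
by case: nx; exists (pR ^+ k * v); rewrite xv exprS expr1 mulrA.
Qed.

Lemma pdvd_prime (x y : R) : pdvd p 1 (x * y) -> pdvd p 1 x \/ pdvd p 1 y.
Proof.
move=> xy; have [|nx] := classic (pdvd p 1 x); [by left | right].
have ux := not_pdvd_unit nx.
by rewrite -[y](mulKr ux); apply: pdvdMl.
Qed.

Lemma pdvdXS k (x : R) : pdvd p k.+1 (pR ^+ k * x) -> pdvd p 1 x.
Proof.
case=> y; rewrite exprSr -mulrA => /(mulfI (pX_neq0 k)) ->.
by exists y; rewrite expr1.
Qed.

Lemma pdvd_all0 (x : R) : (forall k, pdvd p k x) -> x = 0.
Proof.
move=> h; apply/eqP; apply: contraT => x0.
case: HR => _ [_ /(_ x x0)[k [v [uv xv]]] _ _ _].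
by case: (unit_not_pdvd uv); have := h k.+1; rewrite xv => /pdvdXS.
Qed.

Lemma phi_p : phi pR = pR.
Proof. exact: rmorph_nat. Qed.

Lemma pdvd_phi k (x : R) : pdvd p k x -> pdvd p k (phi x).
Proof. by case=> y ->; exists (phi y); rewrite rmorphM rmorphXn phi_p. Qed.

(** Writing x as p^j times a unit shows that phi preserves the valuation. *)
Lemma pdvd_phiV k (x : R) : pdvd p k (phi x) -> pdvd p k x.
Proof.
move=> h; have [->|x0] := eqVneq x 0; first exact: pdvd0.
case: HR => _ [_ /(_ x x0)[j [v [uv xv]]] _ _ _].
have [kj|jk] := leqP k j; first by apply: (pdvd_leq kj); exists v.
have uphi : phi v \is a GRing.unit by apply: rmorph_unit.
case: (unit_not_pdvd uphi); apply: (@pdvdXS j); apply: (pdvd_leq jk).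
by move: h; rewrite xv rmorphM rmorphXn phi_p.
Qed.

(** The cofactor of x - y in x^p - y^p is congruent to p x^(p-1), hence to 0, modulo p. *)
Lemma pow_p_cong k (x y : R) :
  pdvd p k.+1 (x - y) -> pdvd p k.+2 (x ^+ p - y ^+ p).
Proof.
move=> h; have h1 : pdvd p 1 (x - y) by apply: pdvd_leq h.
have : pdvd p 1 (\sum_(i < p) x ^+ (p.-1 - i) * y ^+ i).
  have -> : \sum_(i < p) x ^+ (p.-1 - i) * y ^+ i
      = (\sum_(i < p) x ^+ (p.-1 - i) * y ^+ i - \sum_(i < p) x ^+ (p.-1 - i) * x ^+ i)
        + pR * x ^+ p.-1.
    rewrite [X in _ - X + _](eq_bigr (fun=> x ^+ p.-1)).
      by rewrite sumr_const card_ord mulr_natl subrK.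
    move=> i _; rewrite -exprD subnK //.
    by rewrite -ltnS prednK ?prime_gt0.
  apply: pdvdD; last by exists (x ^+ p.-1); rewrite expr1.
  apply: cong_sum => i; apply: congM; first exact: cong_refl.
  by apply: congX; apply: pdvd_sym.
rewrite subrXX; case: h => a -> [b ->].
exists (a * b); rewrite expr1 [pR ^+ k.+2]exprS.
by ring.
Qed.

(** If another prime q were 0 in R, a Bezout relation would make p invertible. *)
Lemma char0_R : [pchar R] =i pred0.
Proof.
move=> q; rewrite inE; apply/negP => /andP[q_prime /eqP q0].
have [qp|qp] := eqVneq q p; first by have := pR_neq0; rewrite -qp q0 eqxx.
have [u v e _] := egcdnP q (prime_gt0 p_prime).
have co : gcdn p q = 1%N by apply/eqP; rewrite -/(coprime p q) prime_coprime // dvdn_prime2 // eq_sym.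
have := congr1 (fun m => m%:R : R) e; rewrite co natrD natrM natrM q0 mulr0 add0r => pu.
apply: (@unit_not_pdvd 1); first exact: unitr1.
by exists u%:R; rewrite expr1 mulrC.
Qed.

Section Matrices.
Variable n : nat.
Implicit Types u v g h : 'M[R]_n.

Lemma close_refl k u : close p k u u.
Proof. by move=> i j; rewrite !mxE; apply: cong_refl. Qed.

Lemma close_sym k u v : close p k u v -> close p k v u.
Proof. by move=> h i j; have := h i j; rewrite !mxE; apply: pdvd_sym. Qed.

Lemma close_trans k u v g : close p k u v -> close p k v g -> close p k u g.
Proof.
by move=> h1 h2 i j; have := h2 i j; have := h1 i j; rewrite !mxE; apply: pdvd_trans.
Qed.

Lemma close_leq k l u v : (l <= k)%N -> close p k u v -> close p l u v.
Proof. by move=> lk h i j; apply: pdvd_leq lk (h i j). Qed.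

Lemma close_mul k u v g h : close p k u v -> close p k g h -> close p k (u *m g) (v *m h).
Proof.
move=> h1 h2 i j; rewrite !mxE; apply: cong_sum => a; apply: congM.
  by have := h1 i a; rewrite !mxE.
by have := h2 a j; rewrite !mxE.
Qed.

Lemma close_det k u v : close p k u v -> pdvd p k (\det u - \det v).
Proof.
move=> h; apply: cong_sum => s; apply: congM; first exact: cong_refl.
by apply: cong_prod => i; have := h i (s i); rewrite !mxE.
Qed.

Lemma close_unit u v : close p 1 u v -> v \in unitmx -> u \in unitmx.
Proof.
move=> /close_det h; rewrite !unitmxE => uv; apply: not_pdvd_unit => hu.
by apply: (unit_not_pdvd uv); have := pdvdB hu h; rewrite subKr.
Qed.

Lemma close_inv k u v : u \in unitmx -> v \in unitmx -> close p k u v ->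
  close p k (invmx u) (invmx v).
Proof.
move=> uu uv h; have := close_mul (close_mul (close_refl k (invmx u)) h) (close_refl k (invmx v)).
by rewrite mulVmx // mul1mx mulmxK // => /close_sym.
Qed.

Definition Vmx u : 'M[R]_n := map_mx (fun x => x ^+ p) u.

Lemma close_phiV k u v : close p k (map_mx phi u) (map_mx phi v) -> close p k u v.
Proof.
by move=> h i j; apply: pdvd_phiV; have := h i j; rewrite !mxE rmorphB.
Qed.

Lemma close_Vmx k u v : close p k u v -> close p k (Vmx u) (Vmx v).
Proof. by move=> h i j; have := h i j; rewrite !mxE; apply: congX. Qed.

Lemma close_VmxS k u v : close p k.+1 u v -> close p k.+2 (Vmx u) (Vmx v).
Proof. by move=> h i j; have := h i j; rewrite !mxE; apply: pow_p_cong. Qed.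

Lemma close_Vmx_phi u : close p 1 (map_mx phi u) (Vmx u).
Proof. by move=> i j; rewrite !mxE; apply: Hphi. Qed.

Lemma Vmx_unit u : u \in unitmx -> Vmx u \in unitmx.
Proof.
move=> uu; apply: (close_unit (close_sym (close_Vmx_phi u))).
by rewrite unitmxE det_map_mx rmorph_unit.
Qed.

Lemma close_all_eq u v : (forall k, close p k u v) -> u = v.
Proof.
move=> h; apply/matrixP => i j; apply/eqP; rewrite -subr_eq0; apply/eqP.
by apply: pdvd_all0 => k; have := h k i j; rewrite !mxE.
Qed.

(* Taking p-th powers gains one p-adic digit and phi loses none, so a solution
   is determined by its residue. *)
Lemma frob_rigid u g h : u \in unitmx ->
    Vmx u *m map_mx phi g = Vmx (u *m g) -> Vmx u *m map_mx phi h = Vmx (u *m h) ->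
  close p 1 g h -> g = h.
Proof.
move=> uu eg eh gh; apply: close_all_eq => k.
suff: close p k.+1 g h by apply: close_leq.
elim: k => // k IHk; apply: close_phiV.
rewrite -[map_mx phi g](mulKmx (Vmx_unit uu)) -[map_mx phi h](mulKmx (Vmx_unit uu)).
apply: close_mul; first exact: close_refl.
by rewrite eg eh; apply: close_VmxS; apply: close_mul => //; apply: close_refl.
Qed.

End Matrices.

Lemma iter_phi_cong m (a : R) : pdvd p 1 (iter m phi a - a ^+ (p ^ m)).
Proof.
elim: m => [|m IHm]; first by rewrite expn0 expr1; apply: cong_refl.
rewrite iterS expnSr exprM; apply: pdvd_trans (Hphi _) _.
exact: congX.
Qed.

(** The residue of a lies in the field with p^M elements. Since phi^M is a ring map, closure under
    sums and products is immediate. *)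
Definition phi_fixed_mod M (a : R) := pdvd p 1 (iter M phi a - a).

Lemma phi_fixed_mod_mul M k (a : R) : phi_fixed_mod M a -> phi_fixed_mod (k * M) a.
Proof.
move=> h; elim: k => [|k IHk]; first exact: cong_refl.
rewrite /phi_fixed_mod mulSn iterD.
apply: pdvd_trans (_ : pdvd p 1 (iter M phi (iter (k * M) phi a) - iter M phi a)) h.
have phiB m x y : iter m phi x - iter m phi y = iter m phi (x - y).
  by elim: m => //= m IHm; rewrite -IHm rmorphB.
have phi_pdvd m x : pdvd p 1 x -> pdvd p 1 (iter m phi x).
  by move=> hx; elim: m => //= m; apply: pdvd_phi.
by rewrite phiB; apply: phi_pdvd.
Qed.

Lemma phi_fixed_mod_ex (s : seq R) : exists M, (0 < M)%N /\
  forall a, a \in s -> phi_fixed_mod M a.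
Proof.
elim: s => [|a s [M [M0 IHs]]]; first by exists 1%N.
case: HR => _ [_ _ _ _ /(_ a)[m [m0 am]]]; exists (M * m)%N; split.
  by rewrite muln_gt0 M0.
move=> b; rewrite inE => /predU1P[->|/IHs].
  by apply: phi_fixed_mod_mul; apply: pdvd_trans (iter_phi_cong m a) am.
by rewrite mulnC; apply: phi_fixed_mod_mul.
Qed.

Lemma phi_fixed_mod1 M : phi_fixed_mod M 1.
Proof.
rewrite /phi_fixed_mod (_ : iter M phi 1 = 1); first exact: cong_refl.
by elim: M => //= M ->; rewrite rmorph1.
Qed.

Lemma phi_fixed_mod0 M : phi_fixed_mod M 0.
Proof.
rewrite /phi_fixed_mod (_ : iter M phi 0 = 0); first exact: cong_refl.
by elim: M => //= M ->; rewrite rmorph0.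
Qed.

Lemma phi_fixed_modD M a b : phi_fixed_mod M a -> phi_fixed_mod M b -> phi_fixed_mod M (a + b).
Proof.
move=> ha hb; rewrite /phi_fixed_mod (_ : iter M phi (a + b) = iter M phi a + iter M phi b).
  exact: congD.
by elim: (M) => //= m ->; rewrite rmorphD.
Qed.

Lemma phi_fixed_modM M a b : phi_fixed_mod M a -> phi_fixed_mod M b -> phi_fixed_mod M (a * b).
Proof.
move=> ha hb; rewrite /phi_fixed_mod (_ : iter M phi (a * b) = iter M phi a * iter M phi b).
  exact: congM.
by elim: (M) => //= m ->; rewrite rmorphM.
Qed.

(** The root count over the residue field, carried out in R: X - a divides f - f(a) exactly, and p
    is prime. *)
Lemma monic_roots_mod d (f : {poly R}) (s : seq R) :
    f \is monic -> size f = d.+1 ->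
    rfree (fun x y => pdvd p 1 (x - y)) s -> (forall x, x \in s -> pdvd p 1 f.[x]) ->
  (size s <= d)%N.
Proof.
elim: d f s => [|d IHd] f s fm sf.
  case: s => // a s _ /(_ a (mem_head _ _)).
  have f0 : f = (f`_0)%:P by apply: size1_polyC; rewrite sf.
  have -> : f = 1.
    by move: fm; rewrite f0 monicE lead_coefC => /eqP->.
  by rewrite hornerC => /(unit_not_pdvd (unitr1 _)).
case: s => // a s [as_ fs] roots.
have /factor_theorem[g fg] : root (f - f.[a]%:P) a.
  by rewrite /root hornerD hornerN hornerC subrr.
have sc : (size (- f.[a]%:P : {poly R}) < size f)%N.
  by rewrite size_polyN sf (leq_ltn_trans (size_polyC_leq1 _)).
have gX : g * ('X - a%:P) \is monic.
  by rewrite -fg monicE lead_coefDl // -monicE.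
have gm : g \is monic by move: gX; rewrite monicMr ?monicXsubC.
rewrite ltnS; apply: (IHd g s) => //.
  have : size (g * ('X - a%:P)) = d.+2 by rewrite -fg size_polyDl.
  by rewrite size_Mmonic ?monicXsubC ?monic_neq0 // size_XsubC addn2 /= => -[].
move=> x xs; have fx : pdvd p 1 f.[x] by apply: roots; rewrite inE xs orbT.
have fa : pdvd p 1 f.[a] by apply: roots; rewrite mem_head.
have := pdvdB fx fa; have := congr1 (fun q => q.[x]) fg.
rewrite !hornerE /= => -> /pdvd_prime[//|h].
by case: (as_ x xs); apply: pdvd_sym.
Qed.

Lemma phi_fixed_mod_reps M : (0 < M)%N -> exists l : seq R,
  forall a, phi_fixed_mod M a -> exists b, b \in l /\ pdvd p 1 (a - b).
Proof.
move=> M0; have q1 : (1 < p ^ M)%N by rewrite -{1}(exp1n M) ltn_exp2r // prime_gt1.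
have [|l [_ _ H]] := @rfree_maximal _ (fun x y : R => pdvd p 1 (x - y)) (phi_fixed_mod M) (p ^ M).
  move=> s fs sP; apply: (@monic_roots_mod _ ('X^(p ^ M) - 'X)) fs _.
  - by rewrite monicE lead_coefDl ?lead_coefXn // size_polyN size_polyX size_polyXn.
  - by rewrite size_polyDl ?size_polyXn // size_polyN size_polyX.
  move=> x /sP h; rewrite !hornerE /=.
  by apply: pdvd_trans (pdvd_sym (iter_phi_cong M x)) h.
by exists l.
Qed.

(** The residues of the given matrices lie in one finite field. The elements of T with residues in
    that field form a group, and by rigidity they are determined by finitely many possible
    residues. *)
Lemma residually_rigid_locally_finite n (T : 'M[R]_n -> Prop) :
    T 1%:M -> (forall g h, T g -> T h -> T (g *m h)) ->
    (forall g, T g -> g \in unitmx) ->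
    (forall g h, T g -> T h -> close p 1 g h -> g = h) ->
  forall s : seq 'M[R]_n, (forall x, x \in s -> T x) ->
    exists L, [/\ mx_fingroup L, {subset s <= L} & forall x, x \in L -> T x].
Proof.
move=> T1 TM TU Trig s sT.
have [M [M0 sM]] := phi_fixed_mod_ex
  [seq (g : 'M[R]_n) ij.1 ij.2 | g <- s, ij <- enum {: 'I_n * 'I_n}].
have [l lP] := phi_fixed_mod_reps M0.
pose T' (g : 'M[R]_n) := T g /\ forall i j, phi_fixed_mod M (g i j).
pose rep (a : R) : 'I_(size l).+1 :=
  epsilon (inhabits ord0) (fun i : 'I__ => pdvd p 1 (a - nth 0 l i)).
have repP a : phi_fixed_mod M a -> pdvd p 1 (a - nth 0 l (rep a)).
  move=> /lP[b [bl ab]].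
  have bi : (index b l < (size l).+1)%N by rewrite ltnW // ltnS index_mem.
  apply: (epsilon_spec (inhabits ord0)
    (fun i : 'I_(size l).+1 => pdvd p 1 (a - nth 0 l i))).
  by exists (Ordinal bi); rewrite /= nth_index.
pose f (g : 'M[R]_n) := [ffun ij : 'I_n * 'I_n => rep (g ij.1 ij.2)].
have [|L [uL LP]] := @finite_enum _ T' #|{: {ffun 'I_n * 'I_n -> 'I_(size l).+1}}|.
  move=> t ut tT'; have uf : uniq (map f t).
    rewrite map_inj_in_uniq // => g h /tT'[Tg Mg] /tT'[Th Mh] /ffunP e.
    apply: Trig => // i j; have /= := e (i, j); rewrite !ffunE /= => eij.
    rewrite !mxE; apply: pdvd_trans (repP _ (Mg i j)) _.
    by rewrite eij; apply: pdvd_sym; apply: repP.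
  by rewrite -(size_map f) -(card_uniqP uf) max_card.
exists L; split.
- split=> //.
  + apply/LP; split=> // i j; rewrite mxE; case: eqP => _.
      exact: phi_fixed_mod1.
    exact: phi_fixed_mod0.
  + by move=> g /LP[/TU].
  + move=> g h /LP[Tg Mg] /LP[Th Mh]; apply/LP; split; first exact: TM.
    move=> i j; rewrite mxE; apply: (big_ind (phi_fixed_mod M)).
    * exact: phi_fixed_mod0.
    * by move=> x y; apply: phi_fixed_modD.
    * by move=> k _; apply: phi_fixed_modM.
- move=> g gs; apply/LP; split; first exact: sT.
  by move=> i j; apply: sM; apply/allpairsP; exists (g, (i, j)); rewrite mem_enum.
- by move=> g /LP[].
Qed.

End PDivisibility.

Lemma invmx_mul (R : comUnitRingType) n (g h : 'M[R]_n) :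
  g \in unitmx -> h \in unitmx -> invmx (g *m h) = invmx h *m invmx g.
Proof.
move=> ug uh; have ugh : g *m h \in unitmx by rewrite unitmx_mul ug.
have e : g *m h *m (invmx h *m invmx g) = 1%:M by rewrite mulmxA mulmxK // mulmxV.
by rewrite -[RHS](mulKmx ugh) e mulmx1.
Qed.

(** * The Galois group *)

Section Subrings.
Variables (R : idomainType) (S : R -> Prop).
Hypothesis sS : subring S.

Lemma subring1 : S 1. Proof. by case: sS. Qed.

Lemma subringB x y : S x -> S y -> S (x - y).
Proof. by case: sS => _ h hx hy; case: (h x y hx hy). Qed.

Lemma subringM x y : S x -> S y -> S (x * y).
Proof. by case: sS => _ h hx hy; case: (h x y hx hy). Qed.

Lemma subring0 : S 0.
Proof. by rewrite -(subrr 1); apply: subringB; apply: subring1. Qed.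

Lemma subringN x : S x -> S (- x).
Proof. by move=> hx; rewrite -sub0r; apply: subringB => //; apply: subring0. Qed.

Lemma subringD x y : S x -> S y -> S (x + y).
Proof. by move=> hx hy; rewrite -[y]opprK; apply: subringB => //; apply: subringN. Qed.

Lemma subringX x m : S x -> S (x ^+ m).
Proof.
move=> hx; elim: m => [|m IHm]; first exact: subring1.
by rewrite exprS; apply: subringM.
Qed.

Lemma subring_nat m : S m%:R.
Proof.
elim: m => [|m IHm]; first exact: subring0.
by rewrite -natr1; apply: subringD => //; apply: subring1.
Qed.

Lemma subring_sum (I : Type) (s : seq I) (P : pred I) (f : I -> R) :
  (forall i, S (f i)) -> S (\sum_(i <- s | P i) f i).
Proof. by move=> h; apply: big_ind => //; [apply: subring0 | apply: subringD]. Qed.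

Lemma subring_prod (I : Type) (s : seq I) (P : pred I) (f : I -> R) :
  (forall i, S (f i)) -> S (\prod_(i <- s | P i) f i).
Proof. by move=> h; apply: big_ind => //; [apply: subring1 | apply: subringM]. Qed.

Lemma mx_over_mul n (A B : 'M[R]_n) : mx_over S A -> mx_over S B -> mx_over S (A *m B).
Proof. by move=> hA hB i j; rewrite mxE; apply: subring_sum => k; apply: subringM. Qed.

Lemma mx_over1 n : mx_over S (1%:M : 'M[R]_n).
Proof. by move=> i j; rewrite mxE; apply: subring_nat. Qed.

End Subrings.

Section GaloisRelation.
Variables (p : nat) (R : idomainType) (phi : {rmorphism R -> R}) (delta : R -> R).
Hypotheses (p_prime : prime p) (HR : Witt_Fpbar R p) (Hphi : Frob_lift p phi).
Hypothesis Hdelta : delta_spec p phi delta.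
Variable n : nat.
Implicit Types u g : 'M[R]_n.

Lemma phi_delta x : phi x = p%:R * delta x + x ^+ p.
Proof. by rewrite Hdelta subrK. Qed.

Lemma alpha_ofE u : u \in unitmx -> map_mx delta u = alpha_of p delta u *m Vmx p u.
Proof. by move=> uu; rewrite /alpha_of -mulmxA mulVmx ?mulmx1 // (Vmx_unit HR Hphi). Qed.

Lemma phi_alpha (a : 'M[R]_n) u : map_mx delta u = a *m Vmx p u ->
  map_mx phi u = (p%:R *: a + 1%:M) *m Vmx p u.
Proof.
move=> e; rewrite mulmxDl mul1mx -scalemxAl -e.
by apply/matrixP => i j; rewrite !mxE phi_delta.
Qed.

(** With b = 1 + p alpha the two equations read phi(u) = b V(u) and phi(ug) = b V(ug). As b is
    invertible, alpha disappears from the relation. *)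
Lemma frob_relation u g : u \in unitmx ->
  map_mx delta (u *m g) = alpha_of p delta u *m Vmx p (u *m g) ->
  Vmx p u *m map_mx phi g = Vmx p (u *m g).
Proof.
move=> uu /phi_alpha eg; have /phi_alpha eu := alpha_ofE uu.
set b := _ + _ in eg eu.
have ub : b \in unitmx.
  have : map_mx phi u \in unitmx by rewrite unitmxE det_map_mx rmorph_unit.
  by rewrite eu unitmx_mul => /andP[].
apply: (can_inj (mulKmx ub)).
by rewrite -eg map_mxM eu mulmxA.
Qed.

Section Group.
Variables (O : R -> Prop) (u : 'M[R]_n).
Hypotheses (sO : subring O) (uu : u \in unitmx) (aO : mx_over O (alpha_of p delta u)).

Lemma gen_ring_subring : subring (gen_ring delta O u).
Proof.
split; first by move=> S sS _ _; apply: subring1.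
move=> x y hx hy; split=> S sS OS uS.
  by apply: subringB => //; [apply: hx | apply: hy].
by apply: subringM => //; [apply: hx | apply: hy].
Qed.

Lemma gen_ring_base x : O x -> gen_ring delta O u x.
Proof. by move=> Ox S _ OS _; apply: OS. Qed.

Lemma gen_ring_iter k i j : gen_ring delta O u (iter k (map_mx delta) u i j).
Proof. by move=> S _ _; apply. Qed.

Section Automorphism.
Variable sigma : R -> R.
Local Notation A := (gen_ring delta O u).
Hypothesis sigmaM : forall x y, A x -> A y ->
  sigma (x + y) = sigma x + sigma y /\ sigma (x * y) = sigma x * sigma y.
Hypothesis sigmaO : forall a, O a -> sigma a = a.

Lemma sigma_sum (I : Type) (s : seq I) (f : I -> R) : (forall i, A (f i)) ->
  sigma (\sum_(i <- s) f i) = \sum_(i <- s) sigma (f i).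
Proof.
move=> Af; elim: s => [|i s IHs]; first by rewrite !big_nil sigmaO //; apply: (subring0 sO).
have As : A (\sum_(j <- s) f j) by apply: (subring_sum gen_ring_subring).
by rewrite !big_cons -IHs; case: (sigmaM (Af i) As).
Qed.

Lemma sigma_exp x m : A x -> sigma (x ^+ m) = sigma x ^+ m.
Proof.
move=> Ax; elim: m => [|m IHm]; first by rewrite !expr0 sigmaO //; apply: (subring1 sO).
have Am : A (x ^+ m) by apply: (subringX gen_ring_subring).
by rewrite !exprS -IHm; case: (sigmaM Ax Am).
Qed.

Lemma sigma_mulmx (a b : 'M[R]_n) : mx_over A a -> mx_over A b ->
  map_mx sigma (a *m b) = map_mx sigma a *m map_mx sigma b.
Proof.
move=> Aa Ab; apply/matrixP => i j; rewrite !mxE sigma_sum => [|k].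
  by apply: eq_bigr => k _; rewrite !mxE; case: (sigmaM (Aa i k) (Ab k j)).
by apply: (subringM gen_ring_subring).
Qed.

Lemma sigma_base (a : 'M[R]_n) : mx_over O a -> map_mx sigma a = a.
Proof. by move=> Oa; apply/matrixP => i j; rewrite mxE sigmaO. Qed.

End Automorphism.

Lemma gal_unit g : Gal_group delta O u g -> g \in unitmx.
Proof. by case=> -[]. Qed.

(** The automorphism fixes alpha and commutes with delta, so its value ug at u solves the equation
    of u. *)
Lemma gal_relation g : Gal_group delta O u g ->
  Vmx p u *m map_mx phi g = Vmx p (u *m g).
Proof.
case=> _ [s [_ sM sO' sd sg]]; apply: frob_relation => //.
have su : map_mx s u = u *m g by rewrite -sg mulKVmx.
have Au i j : gen_ring delta O u (u i j) by apply: (gen_ring_iter 0).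
rewrite -su; have -> : map_mx delta (map_mx s u) = map_mx s (map_mx delta u).
  by apply/matrixP => i j; rewrite !mxE sd.
rewrite alpha_ofE // (sigma_mulmx sM sO').
- rewrite (sigma_base sO') //; congr (_ *m _); apply/matrixP => i j; rewrite !mxE.
  exact: (sigma_exp sM sO').
- by move=> i j; apply: gen_ring_base.
- by move=> i j; rewrite mxE; apply: (subringX gen_ring_subring).
Qed.

Lemma gal1 : Gal_group delta O u 1%:M.
Proof.
split.
  split; first exact: unitmx1.
  by rewrite invmx1; split; apply: (mx_over1 sO).
exists id; split=> //; first by split=> //; split=> // y Ay; exists y.
by rewrite map_mx_id // mulVmx.
Qed.

Lemma galM g h : Gal_group delta O u g -> Gal_group delta O u h ->
  Gal_group delta O u (g *m h).
Proof.
case=> -[ug [Og Oig]] [s [[sA [s_on s_inj]] sM sO' sd sg]].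
case=> -[uh [Oh Oih]] [t [[tA [t_on t_inj]] tM tO td tg]].
have Au i j : gen_ring delta O u (u i j) by apply: (gen_ring_iter 0).
split.
  split; first by rewrite unitmx_mul ug.
  split; first exact: (mx_over_mul sO).
  rewrite invmx_mul //; exact: (mx_over_mul sO).
exists (s \o t); split.
- split; first by move=> x /tA/sA.
  split; first by move=> y /s_on[x [/t_on[z [Az <-]] <-]]; exists z.
  by move=> x y Ax Ay /(s_inj _ _ (tA _ Ax) (tA _ Ay))/(t_inj _ _ Ax Ay).
- move=> x y Ax Ay /=; case: (tM _ _ Ax Ay) => -> ->.
  by apply: sM; apply: tA.
- by move=> a Oa; rewrite /= tO ?sO'.
- by move=> x Ax; rewrite /= td // sd //; apply: tA.
rewrite map_mx_comp; have -> : map_mx t u = u *m h by rewrite -tg mulKVmx.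
rewrite (sigma_mulmx sM sO') //; last by move=> i j; apply: gen_ring_base.
by rewrite (sigma_base sO' Oh) mulmxA sg.
Qed.

Lemma gal_locally_finite (s : seq 'M[R]_n) : (forall x, x \in s -> Gal_group delta O u x) ->
  exists L, [/\ mx_fingroup L, {subset s <= L} & forall x, x \in L -> Gal_group delta O u x].
Proof.
apply: (residually_rigid_locally_finite p_prime HR Hphi).
- exact: gal1.
- by move=> *; apply: galM.
- exact: gal_unit.
- move=> g h /gal_relation eg /gal_relation eh.
  exact: (frob_rigid p_prime HR Hphi) eg eh.
Qed.

End Group.
End GaloisRelation.

(** * Locally finite groups are virtually diagonalizable *)

Section VirtuallyDiagonal.
Variables (R : idomainType) (Ka : closedFieldType).
Variable iota : {rmorphism {fraction R} -> Ka}.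
Variables (n : nat) (G : 'M[R]_n -> Prop).
Hypothesis charR : [pchar R] =i pred0.
Hypothesis G1 : G 1%:M.
Hypothesis GM : forall g h, G g -> G h -> G (g *m h).
Hypothesis Glf : forall s : seq 'M[R]_n, (forall x, x \in s -> G x) ->
  exists L, [/\ mx_fingroup L, {subset s <= L} & forall x, x \in L -> G x].

Let f : {rmorphism R -> Ka} := iota \o @tofrac R.

Let f_inj : injective f.
Proof. by move=> x y /fmorph_inj /eqP; rewrite tofrac_eq => /eqP. Qed.

Let Gfin g : G g -> exists L, [/\ mx_fingroup L, g \in L & forall x, x \in L -> G x].
Proof.
move=> Gg; have [|L [gL sL GL]] := Glf (s := [:: g]).
  by move=> x; rewrite inE => /eqP->.
by exists L; split=> //; apply: sL; rewrite mem_head.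
Qed.

Let GU g : G g -> g \in unitmx.
Proof. by case/Gfin=> L [[_ _ + _] Lg _]; apply. Qed.

Let GV g : G g -> G (invmx g).
Proof. by case/Gfin=> L [gL Lg GL]; apply: GL; apply: mx_fingroupV. Qed.

Let fm := map_mx f : 'M[R]_n -> 'M[Ka]_n.

Let fmV g : G g -> fm (invmx g) = invmx (fm g).
Proof.
move=> /GU ug; have e : fm g *m fm (invmx g) = 1%:M.
  by rewrite -[LHS]map_mxM mulmxV ?map_mx1.
by have [uf _] := mulmx1_unit e; rewrite -[LHS](mulKmx uf) e mulmx1.
Qed.

Lemma locally_finite_virtually_diagonal : has_diag_normal_finite_index iota G.
Proof.
have charK : [pchar Ka] =i pred0.
  apply/pcharf0P => m; move/pcharf0P: charR => <-.
  by rewrite -(rmorph_nat f) -(inj_eq f_inj) rmorph0.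
(* The Jordan-Schur theorem concerns matrices over a field, so G is transported to [Ka] by an
   injective map. *)
pose GK X := exists g, G g /\ X = fm g.
have GKlf (s : seq 'M[Ka]_n) : (forall x, x \in s -> GK x) ->
    exists L, [/\ mx_fingroup L, {subset s <= L} & forall x, x \in L -> GK x].
  move=> sG; have [s' [s'G ss']] : exists s', (forall x, x \in s' -> G x) /\ s = map fm s'.
    elim: s sG => [|x s IHs] sG; first by exists [::].
    have [|s' [s'G ->]] := IHs; first by move=> y ys; apply: sG; rewrite inE ys orbT.
    have [g [Gg ->]] := sG x (mem_head _ _).
    by exists (g :: s'); split=> // y; rewrite inE => /predU1P[->|/s'G].
  have [L [gL sL LG]] := Glf s'G; case: (gL) => uL L1 LU LM.
  exists (map fm L); split.
  - split.
    + rewrite map_inj_uniq // => g h /matrixP e.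
      by apply/matrixP => i j; apply: f_inj; have := e i j; rewrite !mxE.
    + by apply/mapP; exists 1%:M; rewrite /fm ?map_mx1.
    + by move=> _ /mapP[g Lg ->]; rewrite unitmxE det_map_mx rmorph_unit // -unitmxE LU.
    + by move=> _ _ /mapP[g Lg ->] /mapP[h Lh ->]; rewrite -map_mxM map_f // LM.
  - by rewrite ss' => _ /mapP[g /sL Lg ->]; apply: map_f.
  - by move=> _ /mapP[g /LG Gg ->]; exists g.
have [J [S [SG SC SJ SV Sc]]] := jordan_schur charK GKlf.
pose H X := exists t : seq 'M[Ka]_n, (forall x, x \in t -> S x) /\
  X = \big[mulmx/1%:M]_(x <- t) x.
have H1 : H 1%:M by exists [::]; split=> //; rewrite big_nil.
have HS x : S x -> H x.
  by exists [:: x]; rewrite big_cons big_nil mulmx1; split=> // y; rewrite inE => /eqP->.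
have HM x y : H x -> H y -> H (x *m y).
  case=> s [sS ->] Hy; elim: s sS => [|z s IHs] sS; first by rewrite big_nil mul1mx.
  rewrite big_cons -mulmxA; have [|t [tS ->]] := IHs.
    by move=> w ws; apply: sS; rewrite inE ws orbT.
  exists (z :: t); rewrite big_cons; split=> // w.
  by rewrite inE => /predU1P[->|/tS //]; apply: sS; rewrite mem_head.
have Hind (P : 'M[Ka]_n -> Prop) : P 1%:M -> (forall x y, S x -> H y -> P y -> P (x *m y)) ->
    forall x, H x -> P x.
  move=> P1 PM _ [t [tS ->]]; elim: t tS => [|x t IHt] tS; first by rewrite big_nil.
  have tS' y : y \in t -> S y by move=> yt; apply: tS; rewrite inE yt orbT.
  rewrite big_cons; apply: PM; [by apply: tS; rewrite mem_head | by exists t | exact: IHt].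
have HC x y : H x -> H y -> x *m y = y *m x.
  move=> Hx; elim/Hind: y / => [|z y Sz Hy xy]; first by rewrite mulmx1 mul1mx.
  rewrite mulmxA; have -> : x *m z = z *m x; last by rewrite -!mulmxA xy.
  elim/Hind: x / Hx {xy} => [|w x Sw Hx xz]; first by rewrite mulmx1 mul1mx.
  by rewrite -mulmxA xz !mulmxA (SC w z).
have GKU x : GK x -> x \in unitmx.
  by case=> g [/GU ug ->]; rewrite unitmxE det_map_mx rmorph_unit // -unitmxE.
have HU x : H x -> x \in unitmx.
  elim/Hind: x / => [|x y /SG/GKU ux _ uy]; first exact: unitmx1.
  by rewrite unitmx_mul ux.
have HV x : H x -> H (invmx x).
  elim/Hind: x / => [|x y Sx Hy Hy']; first by rewrite invmx1.
  have ux := GKU _ (SG _ Sx); have uy := HU _ Hy.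
  by rewrite invmx_mul //; apply: HM => //; apply/HS/SV.
have HJ g x : GK g -> H x -> H (g *m x *m invmx g).
  move=> Gg; have ug := GKU _ Gg.
  elim/Hind: x / => [|x y Sx _ Hy]; first by rewrite mulmx1 mulmxV.
  have -> : g *m (x *m y) *m invmx g = (g *m x *m invmx g) *m (g *m y *m invmx g).
    by rewrite !mulmxA mulmxKV.
  by apply: HM => //; apply/HS/SJ.
exists (fun g => G g /\ H (fm g)); split.
- split; first by rewrite /fm map_mx1.
  split; first by move=> g [/GU].
  move=> g h [Gg Hg] [Gh Hh]; split; first by apply: GM => //; apply: GV.
  by rewrite /fm map_mxM -/fm fmV //; apply: HM => //; apply: HV.
- by move=> h [].
- move=> g h Gg [Gh Hh]; split; first by apply: GM; [apply: GM | apply: GV].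
  by rewrite /fm !map_mxM -/fm fmV //; apply: HJ => //; exists g.
- have [|cs [_ csG csr]] := @rfree_maximal _ (fun x y => S (fm (invmx x *m y))) G J.
    move=> s fs sG; rewrite leqNgt; apply/negP => Js.
    have sG' (i : 'I_J.+1) : G (nth 0 s i).
      by apply: sG; apply: mem_nth; apply: leq_trans (ltn_ord i) _.
    have [|i [j [ij Sij]]] := Sc (fun i => fm (nth 0 s i)).
      by move=> i; exists (nth 0 s i).
    have E (a b : 'I_J.+1) : invmx (fm (nth 0 s a)) *m fm (nth 0 s b)
        = fm (invmx (nth 0 s a) *m nth 0 s b).
      by rewrite /fm map_mxM -/fm fmV.
    have lt (a : 'I_J.+1) : (a < size s)%N by apply: leq_trans (ltn_ord a) _.
    move: ij; rewrite -val_eqE /= neq_ltn => /orP[ij|ji].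
      apply: (rfree_nth (x0 := 0) fs (i := i) (j := j)); first by rewrite ij lt.
      by rewrite -E.
    apply: (rfree_nth (x0 := 0) fs (i := j) (j := i)); first by rewrite ji lt.
    rewrite -E; have := SV _ Sij; set x := fm _; set y := fm _.
    have ux : x \in unitmx by apply: GKU; exists (nth 0 s i).
    have uy : y \in unitmx by apply: GKU; exists (nth 0 s j).
    by rewrite invmx_mul ?unitmx_inv // invmxK.
  exists (size cs), (fun i => nth 0 cs i); split.
    by move=> i; apply: csG; apply: mem_nth.
  move=> g Gg; have [c [c_in Sc']] := csr g Gg.
  have ci : (index c cs < size cs)%N by rewrite index_mem.
  have Gc := csG _ c_in.
  exists (Ordinal ci); rewrite /= nth_index //; split; first by apply: GM => //; apply: GV.
  have -> : invmx c *m g = invmx (invmx g *m c).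
    by rewrite invmx_mul ?unitmx_inv ?GU // invmxK.
  rewrite fmV; last by apply: GM => //; apply: GV.
  exact/HV/HS.
have [|x [g [[Gg _] ->]]|P [uP Pd]] :=
    @torsion_codiagonalizable _ n charK (fun X => exists g, (G g /\ H (fm g)) /\ X = fm g).
- by move=> x y [g [[_ Hg] ->]] [h [[_ Hh] ->]]; apply: HC.
- have [L [gL Lg _]] := Gfin Gg; have [m [m0 gm]] := mx_fingroup_torsion gL Lg.
  exists m; split=> //; have fX k : fm (g ^+ k) = fm g ^+ k.
    elim: k => [|k IHk]; first by rewrite !expr0 [LHS]map_mx1.
    by rewrite !exprS -IHk [LHS]map_mxM.
  by rewrite -fX gm [LHS]map_mx1.
exists P; split=> // h Hh; apply: Pd; by exists h.
Qed.

End VirtuallyDiagonal.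

(** * Generic u: the Galois group is monomial *)

Section BinomialQuotient.
Variables (R : comNzRingType) (p : nat).
Hypothesis p_prime : prime p.

(** The polynomial ((x + y)^p - x^p - y^p)/p with integer coefficients, the correction term in the
    additivity of delta. *)
Definition binom_quot (x y : R) : R :=
  \sum_(i < p.-1) ('C(p, i.+1) %/ p)%:R * (x ^+ (p - i.+1) * y ^+ i.+1).

Lemma exprD_binom_quot (x y : R) :
  (x + y) ^+ p = x ^+ p + y ^+ p + p%:R * binom_quot x y.
Proof.
have p0 := prime_gt0 p_prime.
rewrite exprDn -(big_mkord xpredT (fun i => x ^+ (p - i) * y ^+ i *+ 'C(p, i))).
rewrite big_nat_recr //= big_ltn // big_add1 big_mkord.
rewrite bin0 subn0 expr0 mulr1 mulr1n binn subnn expr0 mul1r mulr1n.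
rewrite addrAC; congr (_ + _); rewrite mulr_sumr; apply: eq_bigr => i _.
rewrite mulrA -natrM mulnC divnK ?mulr_natl //.
by apply: prime_dvd_bin => //; have := ltn_ord i; lia.
Qed.

End BinomialQuotient.

Section PolynomialFunctions.
Variables (R : idomainType) (n : nat) (O : R -> Prop).
Hypothesis sO : subring O.

(* Functions given by polynomials over O in the matrix entries, up to extensional equality. *)
Inductive polyfun : ('M[R]_n -> R) -> Prop :=
| polyfun_const c : O c -> polyfun (fun _ => c)
| polyfun_coord i j : polyfun (fun x => x i j)
| polyfun_sub P Q : polyfun P -> polyfun Q -> polyfun (fun x => P x - Q x)
| polyfun_mul P Q : polyfun P -> polyfun Q -> polyfun (fun x => P x * Q x)
| polyfun_ext P Q : polyfun P -> (forall x, P x = Q x) -> polyfun Q.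

Lemma polyfun_opp P : polyfun P -> polyfun (fun x => - P x).
Proof.
move=> hP; apply: (polyfun_ext (polyfun_sub (polyfun_const (subring0 sO)) hP)) => x.
exact: sub0r.
Qed.

Lemma polyfun_add P Q : polyfun P -> polyfun Q -> polyfun (fun x => P x + Q x).
Proof.
move=> hP hQ; apply: (polyfun_ext (polyfun_sub hP (polyfun_opp hQ))) => x.
by rewrite opprK.
Qed.

Lemma polyfun_exp P m : polyfun P -> polyfun (fun x => P x ^+ m).
Proof.
move=> hP; elim: m => [|m IHm].
  exact: (polyfun_ext (polyfun_const (subring1 sO))).
by apply: (polyfun_ext (polyfun_mul hP IHm)) => x; rewrite exprS.
Qed.

Lemma polyfun_sum (I : Type) (s : seq I) (f : I -> 'M[R]_n -> R) :
  (forall i, polyfun (f i)) -> polyfun (fun x => \sum_(i <- s) f i x).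
Proof.
move=> hf; elim: s => [|i s IHs].
  by apply: (polyfun_ext (polyfun_const (subring0 sO))) => x; rewrite big_nil.
by apply: (polyfun_ext (polyfun_add (hf i) IHs)) => x; rewrite big_cons.
Qed.

Lemma polyfun_nat m : polyfun (fun _ => m%:R).
Proof. by apply: polyfun_const; apply: subring_nat. Qed.

Lemma polyfun_binom_quot p P Q : polyfun P -> polyfun Q ->
  polyfun (fun x => binom_quot p (P x) (Q x)).
Proof.
move=> hP hQ; apply: polyfun_sum => i; apply: polyfun_mul; first exact: polyfun_nat.
by apply: polyfun_mul; apply: polyfun_exp.
Qed.

Lemma polyfun_mulmx P g : mx_over O g -> polyfun P -> polyfun (fun x => P (x *m g)).
Proof.
move=> Og; elim=> [c Oc|i j|P1 P2 _ h1 _ h2|P1 P2 _ h1 _ h2|P1 P2 _ h1 e].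
- exact: polyfun_const.
- apply: (@polyfun_ext (fun x : 'M[R]_n => \sum_k x i k * g k j)); last by move=> x; rewrite mxE.
  apply: polyfun_sum => k; apply: polyfun_mul; first exact: polyfun_coord.
  exact: polyfun_const.
- exact: polyfun_sub.
- exact: polyfun_mul.
- by apply: (polyfun_ext h1) => x; rewrite e.
Qed.

(** Restriction to lines turns vanishing at enough points into an identity of univariate
    polynomials. *)
Lemma polyfun_line P (x y : 'M[R]_n) : polyfun P ->
  exists q : {poly R}, forall t, P (x + t *: y) = q.[t].
Proof.
elim=> [c _|i j|P1 P2 _ [q1 h1] _ [q2 h2]|P1 P2 _ [q1 h1] _ [q2 h2]|P1 P2 _ [q1 h1] e].
- by exists c%:P => t; rewrite hornerC.
- by exists ((x i j)%:P + y i j *: 'X) => t; rewrite !mxE !hornerE mulrC.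
- by exists (q1 - q2) => t; rewrite !hornerE h1 h2.
- by exists (q1 * q2) => t; rewrite !hornerE h1 h2.
- by exists q1 => t; rewrite -e.
Qed.

End PolynomialFunctions.

Section MonomialGalois.
Variables (p : nat) (R : idomainType) (phi : {rmorphism R -> R}) (delta : R -> R).
Hypotheses (p_prime : prime p) (p_odd : odd p) (HR : Witt_Fpbar R p).
Hypotheses (Hphi : Frob_lift p phi) (Hdelta : delta_spec p phi delta).
Variables (n : nat) (O : R -> Prop) (u : 'M[R]_n).
Hypotheses (sO : subring O) (dO : forall x, O x -> O (delta x)).
Hypothesis OV : forall x, x \is a GRing.unit -> O x -> O x^-1.
Hypothesis OR : forall x, Rdelta delta x -> O x.
Hypotheses (uu : u \in unitmx) (aO : mx_over O (alpha_of p delta u)).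
Hypothesis generic_u : forall P, polyfun O P -> P u = 0 -> forall x, P x = 0.

Let pR0 := pR_neq0 HR.

Lemma O_phi x : O x -> O (phi x).
Proof.
move=> Ox; rewrite (phi_delta Hdelta); apply: (subringD sO).
  by apply: (subringM sO); [apply: (subring_nat sO) | apply: dO].
exact: (subringX sO).
Qed.

Lemma delta_eq0 x : phi x = x ^+ p -> delta x = 0.
Proof.
move=> e; apply/eqP; have := Hdelta x; rewrite e subrr => /eqP.
by rewrite mulf_eq0 (negPf pR0).
Qed.

Lemma Rdelta_phi x : Rdelta delta x -> phi x = x ^+ p.
Proof. by rewrite /Rdelta (phi_delta Hdelta) => ->; rewrite mulr0 add0r. Qed.

(** Both sides are polynomials in t that agree at all natural numbers; the coefficient of t gives p
    a^(p-1) b = 0. *)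
Lemma additive_power_zero (a b : R) :
  (forall t, (a + t * b) ^+ p = a ^+ p + t ^+ p * b ^+ p) -> a = 0 \/ b = 0.
Proof.
move=> e; pose q : {poly R} := (a%:P + b *: 'X) ^+ p - ((a ^+ p)%:P + b ^+ p *: 'X^p).
have q0 : q = 0.
  apply/eqP; apply: contraT => /poly_nonroot_seq => /(_ (fun m => m%:R)) [|m].
    exact: natr_inj (char0_R p_prime HR).
  by rewrite /q !hornerE [b * _]mulrC e [_ ^+ p * m%:R ^+ p]mulrC subrr eqxx.
have : q^`().[0] = 0 by rewrite q0 deriv0 horner0.
rewrite /q !derivE deriv_exp !derivE !hornerE /= !hornerMn !hornerE /=.
have p1 : (0 < p.-1)%N by case: (p) (prime_gt1 p_prime) => [|[]].
rewrite expr0n (gtn_eqF p1) mul0rn mulr0 subr0 => /eqP.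
rewrite -mulr_natr !mulf_eq0 (negPf pR0) orbF expf_eq0 p1 /=.
by case/orP => /eqP; [right | left].
Qed.

(** By genericity the relation holds with u replaced by any x. A row with a single 1 gives phi(g) =
    g^p entrywise; a row with entries 1 and t makes the p-th power additive on two entries of a
    column of g. *)
Lemma gal_columns g : Gal_group delta O u g ->
  (forall k j, Rdelta delta (g k j)) /\
  forall j k l, k != l -> g k j = 0 \/ g l j = 0.
Proof.
move=> Gg; have /matrixP rel := gal_relation HR Hphi Hdelta sO uu aO Gg.
have Og : mx_over O g by case: Gg => -[_ []].
have p0 := prime_gt0 p_prime.
(* Since x is arbitrary, one row of the relation per column is enough; row j is taken for column
   j. *)
have key j (x : 'M[R]_n) :
    \sum_k x j k ^+ p * phi (g k j) = (\sum_k x j k * g k j) ^+ p.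
  apply/eqP; rewrite -subr_eq0; apply/eqP.
  apply: (generic_u (P := fun x : 'M[R]_n =>
    \sum_k x j k ^+ p * phi (g k j) - (\sum_k x j k * g k j) ^+ p)).
    apply: polyfun_sub.
      apply: polyfun_sum => // k; apply: polyfun_mul.
        by apply: polyfun_exp => //; apply: polyfun_coord.
      by apply: polyfun_const; apply: O_phi.
    apply: polyfun_exp => //; apply: polyfun_sum => // k; apply: polyfun_mul.
      exact: polyfun_coord.
    exact: polyfun_const.
  have := rel j j; rewrite !mxE => <-; apply/eqP; rewrite subr_eq0; apply/eqP.
  by apply: eq_bigr => k _; rewrite !mxE.
have key2 j k l t : k != l ->
    phi (g k j) + t ^+ p * phi (g l j) = (g k j + t * g l j) ^+ p.
  move=> kl; have := key j (\matrix_(a, b) ((b == k)%:R + t * (b == l)%:R)).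
  have lk : l != k by rewrite eq_sym.
  rewrite (bigD1 k) // (bigD1 l) //= big1 => [|a /andP[ak al]]; last first.
    by rewrite mxE (negPf ak) (negPf al) mulr0 addr0 expr0n (gtn_eqF p0) mul0r.
  rewrite [X in _ = X ^+ _](bigD1 k) // (bigD1 l) //= big1 => [|a /andP[ak al]]; last first.
    by rewrite mxE (negPf ak) (negPf al) mulr0 addr0 mul0r.
  rewrite !mxE !eqxx (negPf kl) (negPf lk) !mulr0 !mulr1 !addr0 !add0r.
  by rewrite expr1n !mul1r.
have Rg k j : phi (g k j) = g k j ^+ p.
  have := key j (\matrix_(a, b) (b == k)%:R).
  rewrite (bigD1 k) //= big1 => [|a ak]; last first.
    by rewrite mxE (negPf ak) expr0n (gtn_eqF p0) mul0r.
  rewrite [X in _ = X ^+ _](bigD1 k) //= big1 => [|a ak]; last first.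
    by rewrite mxE (negPf ak) mul0r.
  by rewrite !mxE eqxx !addr0 expr1n !mul1r.
split; first by move=> k j; apply: delta_eq0.
move=> j k l kl; apply: additive_power_zero => t.
by rewrite -key2 // !Rg.
Qed.

(** Invertibility puts a nonzero entry in each column, and it is the only one. The product of g with
    its inverse shows that this entry is a unit and that different columns use different rows. *)
Lemma gal_sub_Ndelta g : Gal_group delta O u g -> Ndelta delta g.
Proof.
move=> Gg; have ug := gal_unit Gg; have [Rg col] := gal_columns Gg.
split=> //; pose h := invmx g.
have hg : h *m g = 1%:M by rewrite mulVmx.
have colE j k : g k j != 0 -> forall l, l != k -> g l j = 0.
  move=> gk l lk; case: (col j l k lk) => // gk0; by rewrite gk0 eqxx in gk.
have hgE i j k : g k j != 0 -> (h *m g) i j = h i k * g k j.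
  by move=> gk; rewrite mxE (bigD1 k) //= big1 ?addr0 // => l /(colE _ _ gk) ->; rewrite mulr0.
have ex_k j : exists k, g k j != 0.
  apply/existsP; apply: contraT; rewrite negb_exists => /forallP gj.
  have /matrixP/(_ j j) := hg; rewrite !mxE eqxx big1 => [/eqP|k _].
    by rewrite eq_sym oner_eq0.
  by have := gj k; rewrite negbK => /eqP->; rewrite mulr0.
pose kk j := xchoose (ex_k j).
have kkP j : g (kk j) j != 0 by apply: (xchooseP (ex_k j)).
have kk_inv j : h j (kk j) * g (kk j) j = 1.
  by rewrite -hgE ?kkP // hg mxE eqxx.
have kk_inj : injective kk.
  move=> i j eij; apply/eqP; apply: contraT => ij.
  have : (h *m g) i j = 0 by rewrite hg mxE (negPf ij).
  rewrite (hgE _ _ (kk j)) ?kkP // => /eqP; rewrite mulf_eq0 (negPf (kkP j)) orbF -eij => /eqP h0.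
  by have := kk_inv i; rewrite h0 mul0r => /eqP; rewrite eq_sym oner_eq0.
exists (perm kk_inj)^-1%g, (\row_j g (kk j) j); split.
  move=> j; rewrite mxE; apply/unitrP; exists (h j (kk j)).
  by rewrite [X in _ /\ X = _]mulrC kk_inv.
apply/matrixP => i j; rewrite -row_permE !mxE.
have [<-|ne] := eqVneq ((perm kk_inj)^-1%g i) j.
  have e : kk ((perm kk_inj)^-1%g i) = i by rewrite -[LHS](permE kk_inj) permKV.
  by rewrite mulr1n e.
rewrite mulr0n; apply: (colE _ (kk j)) => //; apply: contraNneq ne => ->.
by rewrite -(permE kk_inj) permK.
Qed.

Section Monomial.
Variable g : 'M[R]_n.
Hypothesis Ng : Ndelta delta g.

Lemma monomial_unit : g \in unitmx.
Proof.
case: Ng => -[s [d [ud ->]]] _; rewrite unitmx_mul unitmx_perm unitmxE det_diag.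
by apply: rpred_prod => i _; apply: ud.
Qed.

Lemma monomial_over : mx_over O g.
Proof. by move=> i j; apply: OR; case: Ng. Qed.

Lemma monomial_inv_over : mx_over O (invmx g).
Proof.
have Odet m (A : 'M[R]_m) : mx_over O A -> O (\det A).
  move=> OA; apply: (subring_sum sO) => s; apply: (subringM sO).
    by apply: (subringX sO); apply: (subringN sO); apply: (subring1 sO).
  by apply: (subring_prod sO) => i; apply: OA.
have Og := monomial_over; have ug := monomial_unit.
move=> i j; rewrite /invmx ug !mxE; apply: (subringM sO).
  by apply: OV; [rewrite -unitmxE | apply: Odet].
apply: (subringM sO).
  by apply: (subringX sO); apply: (subringN sO); apply: (subring1 sO).
by apply: Odet => a b; rewrite !mxE.
Qed.

(** Each entry of the product is a sum with at most one nonzero term. *)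
Lemma Vmx_monomial (x : 'M[R]_n) : Vmx p (x *m g) = Vmx p x *m Vmx p g.
Proof.
have p0 := prime_gt0 p_prime.
case: Ng => -[s [d [_ ->]]] _; rewrite -row_permE.
apply/matrixP => i j; rewrite !mxE.
have ne k : k != (s^-1)%g j -> s k != j.
  by apply: contraNneq => <-; rewrite permK.
rewrite (bigD1 ((s^-1)%g j)) //= big1 => [|k /ne kj]; last first.
  by rewrite !mxE (negPf kj) mulr0n mulr0.
rewrite [RHS](bigD1 ((s^-1)%g j)) //= [X in _ = _ + X]big1 => [|k /ne kj]; last first.
  by rewrite !mxE (negPf kj) mulr0n expr0n (gtn_eqF p0) mulr0.
by rewrite !addr0 exprMn !mxE.
Qed.

Lemma delta_monomial : map_mx delta (u *m g) = alpha_of p delta u *m Vmx p (u *m g).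
Proof.
have phig : map_mx phi g = Vmx p g.
  by apply/matrixP => i j; rewrite !mxE; apply: Rdelta_phi; case: Ng.
have /(phi_alpha Hdelta) eu := alpha_ofE delta HR Hphi uu.
have : map_mx phi (u *m g) = (p%:R *: alpha_of p delta u + 1%:M) *m Vmx p (u *m g).
  by rewrite map_mxM eu phig Vmx_monomial mulmxA.
rewrite mulmxDl mul1mx -scalemxAl => /matrixP e; apply/matrixP => i j.
have := e i j; move: (_ *m Vmx p _) => b {e}; move: (u *m g) => w.
by rewrite !mxE (phi_delta Hdelta) => /addIr /(mulfI pR0).
Qed.

(* Q describes delta both at u and at u *m g, so that O[u] is delta-stable and the
   substitution u |-> u *m g commutes with delta. *)
Lemma polyfun_delta P : polyfun O P -> exists Q, [/\ polyfun O Q,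
  Q u = delta (P u) & Q (u *m g) = delta (P (u *m g))].
Proof.
(* Oddness of p enters here, through (-y)^p = - y^p. *)
have deltaB x y : delta (x - y) = delta x - delta y - binom_quot p x (- y).
  apply: (mulfI pR0); rewrite !mulrBr !Hdelta rmorphB exprD_binom_quot //.
  by rewrite exprNn -signr_odd p_odd expr1; ring.
have deltaM x y : delta (x * y) = x ^+ p * delta y + y ^+ p * delta x + p%:R * (delta x * delta y).
  apply: (mulfI pR0); rewrite Hdelta rmorphM !(phi_delta Hdelta) exprMn; ring.
elim=> [c Oc|i j|P1 P2 h1 [Q1 [hQ1 e1 e1']] h2 [Q2 [hQ2 e2 e2']]
       |P1 P2 h1 [Q1 [hQ1 e1 e1']] h2 [Q2 [hQ2 e2 e2']]|P1 P2 _ [Q1 [hQ1 e1 e1']] e].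
- by exists (fun=> delta c); split=> //; apply: polyfun_const; apply: dO.
- exists (fun x => \sum_k alpha_of p delta u i k * x k j ^+ p); split.
  + apply: polyfun_sum => // k; apply: polyfun_mul; first exact: polyfun_const.
    by apply: polyfun_exp => //; apply: polyfun_coord.
  + have /matrixP/(_ i j) := alpha_ofE delta HR Hphi uu; rewrite !mxE => ->.
    by apply: eq_bigr => k _; rewrite !mxE.
  + have /matrixP/(_ i j) := delta_monomial; rewrite [LHS]mxE => ->.
    by rewrite [RHS]mxE; apply: eq_bigr => k _; congr (_ * _); rewrite [RHS]mxE.
- exists (fun x => Q1 x - Q2 x - binom_quot p (P1 x) (- P2 x)); split.
  + apply: polyfun_sub; first exact: polyfun_sub.
    by apply: polyfun_binom_quot => //; apply: polyfun_opp.
  + by rewrite deltaB e1 e2.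
  + by rewrite deltaB e1' e2'.
- exists (fun x => P1 x ^+ p * Q2 x + P2 x ^+ p * Q1 x + p%:R * (Q1 x * Q2 x)); split.
  + apply: polyfun_add => //.
      by apply: polyfun_add => //; apply: polyfun_mul => //; apply: polyfun_exp.
    by apply: polyfun_mul; [apply: polyfun_nat | apply: polyfun_mul].
  + by rewrite deltaM e1 e2.
  + by rewrite deltaM e1' e2'.
- by exists Q1; rewrite -!e.
Qed.

End Monomial.

Lemma Ndelta1 : Ndelta delta (1%:M : 'M[R]_n).
Proof.
split.
  exists 1%g, (const_mx 1); split; first by move=> i; rewrite mxE unitr1.
  by rewrite perm_mx1 mul1mx diag_const_mx.
move=> i j; apply: delta_eq0; rewrite mxE rmorph_nat; case: eqP => _.
  by rewrite expr1n.
by rewrite expr0n (gtn_eqF (prime_gt0 p_prime)).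
Qed.

(** That is, O{u} = O[u]: [polyfun_delta] with g = 1 expresses all derivatives of u as polynomials
    in u. *)
Lemma gen_ring_polyfun x : gen_ring delta O u x <-> exists2 P, polyfun O P & P u = x.
Proof.
split=> [|[P hP <-]]; last first.
  elim: hP => [c Oc|i j|P1 P2 _ h1 _ h2|P1 P2 _ h1 _ h2|P1 P2 _ h1 <- //].
  - exact: gen_ring_base.
  - by move=> S _ _ /(_ 0%N i j).
  - exact: (subringB (gen_ring_subring _ _ _)).
  - exact: (subringM (gen_ring_subring _ _ _)).
move=> /(_ (fun x => exists2 P, polyfun O P & P u = x)); apply.
- split; first by exists (fun=> 1) => //; apply: polyfun_const; apply: (subring1 sO).
  move=> _ _ [P hP <-] [Q hQ <-]; split.
    by exists (fun x => P x - Q x) => //; apply: polyfun_sub.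
  by exists (fun x => P x * Q x) => //; apply: polyfun_mul.
- by move=> c Oc; exists (fun=> c) => //; apply: polyfun_const.
- elim=> [|k IHk] i j; first by exists (fun x => x i j) => //; apply: polyfun_coord.
  have [P hP eP] := IHk i j; have [Q [hQ eQ _]] := polyfun_delta Ndelta1 hP.
  by exists Q => //; rewrite iterS mxE eQ eP.
Qed.

(** By genericity an element of O[u] comes from a unique polynomial function, so the substitution of
    ug for u is well defined; the substitution of u g^-1 inverts it. *)
Lemma Ndelta_sub_gal g : Ndelta delta g -> Gal_group delta O u g.
Proof.
move=> Ng; have ug := monomial_unit Ng.
have Og := monomial_over Ng; have Oig := monomial_inv_over Ng.
split; first by [].
pose rep x := epsilon (inhabits (fun _ : 'M[R]_n => 0 : R)) (fun P => polyfun O P /\ P u = x).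
pose sig x := rep x (u *m g).
have gen P Q : polyfun O P -> polyfun O Q -> P u = Q u -> forall x, P x = Q x.
  move=> hP hQ e x; apply/eqP; rewrite -subr_eq0; apply/eqP.
  by apply: (generic_u (polyfun_sub hP hQ)); rewrite e subrr.
have sigE P : polyfun O P -> sig (P u) = P (u *m g).
  move=> hP; have [hr er] : polyfun O (rep (P u)) /\ rep (P u) u = P u.
    by apply: (epsilon_spec _ (fun Q => polyfun O Q /\ Q u = P u)); exists P.
  exact: gen.
exists sig; split.
- split; first move=> x /gen_ring_polyfun[P hP <-].
    apply/gen_ring_polyfun; rewrite sigE //.
    by exists (fun x => P (x *m g)) => //; apply: polyfun_mulmx.
  split.
    move=> y /gen_ring_polyfun[P hP <-].
    have hP' := polyfun_mulmx sO Oig hP.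
    exists (P (u *m invmx g)); split; first by apply/gen_ring_polyfun; exists (fun x => P (x *m invmx g)).
    by rewrite (sigE _ hP') mulmxK.
  move=> x y /gen_ring_polyfun[P hP <-] /gen_ring_polyfun[Q hQ <-].
  rewrite !sigE // => e.
  have := gen _ _ (polyfun_mulmx sO Og hP) (polyfun_mulmx sO Og hQ) e (u *m invmx g).
  by rewrite mulmxKV.
- move=> x y /gen_ring_polyfun[P hP <-] /gen_ring_polyfun[Q hQ <-]; split.
    by rewrite (sigE _ (polyfun_add sO hP hQ)) !sigE.
  by rewrite (sigE _ (polyfun_mul hP hQ)) !sigE.
- by move=> a Oa; rewrite (sigE _ (polyfun_const n Oa)).
- move=> x /gen_ring_polyfun[P hP <-]; have [Q [hQ eQ eQ']] := polyfun_delta Ng hP.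
  by rewrite -eQ !sigE.
- have -> : map_mx sig u = u *m g.
    by apply/matrixP => i j; rewrite mxE (sigE _ (polyfun_coord O i j)).
  by rewrite mulKmx.
Qed.

End MonomialGalois.

(** * Genericity outside a set of the first category *)

Section RationalGerms.
Variable L : fieldType.
Implicit Types (t : L) (h : L -> L).

(** The identity is claimed only off the zeros of Q, so inverses are allowed whenever they are
    regular at t. *)
Definition rational_at t h : Prop := exists P Q : {poly L},
  Q.[t] != 0 /\ forall s, Q.[s] != 0 -> h s = P.[s] / Q.[s].

Lemma rational_ext t h h' : rational_at t h -> (forall s, h s = h' s) -> rational_at t h'.
Proof. by case=> P [Q [Q0 e]] ee; exists P, Q; split=> // s /e; rewrite ee. Qed.

Lemma rational_const t c : rational_at t (fun _ => c).
Proof. by exists c%:P, 1; rewrite hornerC oner_eq0; split=> // s _; rewrite !hornerC divr1. Qed.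

Lemma rational_id t : rational_at t (fun s => s).
Proof. by exists 'X, 1; rewrite hornerC oner_eq0; split=> // s _; rewrite hornerX hornerC divr1. Qed.

Lemma rational_sub t h1 h2 : rational_at t h1 -> rational_at t h2 ->
  rational_at t (fun s => h1 s - h2 s).
Proof.
case=> P1 [Q1 [n1 e1]] [P2 [Q2 [n2 e2]]]; exists (P1 * Q2 - P2 * Q1), (Q1 * Q2).
rewrite hornerM mulf_neq0 //; split=> // s.
rewrite !hornerE mulf_eq0 negb_or => /andP[s1 s2]; rewrite e1 // e2 //.
by field; apply/andP.
Qed.

Lemma rational_mul t h1 h2 : rational_at t h1 -> rational_at t h2 ->
  rational_at t (fun s => h1 s * h2 s).
Proof.
case=> P1 [Q1 [n1 e1]] [P2 [Q2 [n2 e2]]]; exists (P1 * P2), (Q1 * Q2).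
rewrite hornerM mulf_neq0 //; split=> // s.
rewrite !hornerE mulf_eq0 negb_or => /andP[s1 s2]; rewrite e1 // e2 //.
by field; apply/andP.
Qed.

Lemma rational_add t h1 h2 : rational_at t h1 -> rational_at t h2 ->
  rational_at t (fun s => h1 s + h2 s).
Proof.
move=> r1 r2; apply: rational_ext (rational_sub r1 (rational_sub (rational_const t 0) r2)) _ => s.
by rewrite sub0r opprK.
Qed.

Lemma rational_inv t h : h t != 0 -> rational_at t h -> rational_at t (fun s => (h s)^-1).
Proof.
move=> ht [P [Q [n1 e1]]]; exists (Q * Q), (P * Q).
have Pt : P.[t] != 0 by apply: contraNneq ht; rewrite e1 // => ->; rewrite mul0r.
rewrite hornerM mulf_neq0 //; split=> // s.
rewrite !hornerE mulf_eq0 negb_or => /andP[s1 s2]; rewrite e1 //.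
by field; apply/andP.
Qed.

Lemma rational_sum t (I : Type) (r : seq I) (h : I -> L -> L) :
  (forall i, rational_at t (h i)) -> rational_at t (fun s => \sum_(i <- r) h i s).
Proof.
move=> rh; elim: r => [|i r IHr].
  by apply: rational_ext (rational_const t 0) _ => s; rewrite big_nil.
by apply: rational_ext (rational_add (rh i) IHr) _ => s; rewrite big_cons.
Qed.

Lemma rational_prod t (I : Type) (r : seq I) (h : I -> L -> L) :
  (forall i, rational_at t (h i)) -> rational_at t (fun s => \prod_(i <- r) h i s).
Proof.
move=> rh; elim: r => [|i r IHr].
  by apply: rational_ext (rational_const t 1) _ => s; rewrite big_nil.
by apply: rational_ext (rational_mul (rh i) IHr) _ => s; rewrite big_cons.
Qed.

Lemma rational_exp t h m : rational_at t h -> rational_at t (fun s => h s ^+ m).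
Proof.
move=> rh; elim: m => [|m IHm]; first by apply: rational_ext (rational_const t 1) _.
by apply: rational_ext (rational_mul rh IHm) _ => s; rewrite exprS.
Qed.

Lemma rational_det t m (A : L -> 'M[L]_m) :
  (forall i j, rational_at t (fun s => A s i j)) -> rational_at t (fun s => \det (A s)).
Proof.
move=> rA; apply: rational_sum => w; apply: rational_mul; first exact: rational_const.
by apply: rational_prod => i.
Qed.

(* One coordinate of a nonvanishing point is changed at a time, along a line on which the
   function is rational and regular at the starting point. *)
Lemma nonvanishing_at_nat (I : finType) (H : {ffun I -> L} -> L) (t : {ffun I -> L}) :
    [pchar L] =i pred0 ->
    (forall t : {ffun I -> L}, H t != 0 -> forall i,
       rational_at (t i) (fun s => H [ffun j => if j == i then s else t j])) ->
    H t != 0 ->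
  exists tau : {ffun I -> nat}, H [ffun i => (tau i)%:R] != 0.
Proof.
move=> charL rH Ht.
have step (s : seq I) : exists t' : {ffun I -> L}, H t' != 0 /\ forall i, i \in s -> exists m : nat, t' i = m%:R.
  elim: s => [|i s [t' [Ht' st']]]; first by exists t.
  have [P [Q [Qt e]]] := rH t' Ht' i.
  have Pt : P.[t' i] != 0.
    have := e _ Qt; rewrite (_ : [ffun j => _] = t') => [eH|]; last first.
      by apply/ffunP => j; rewrite ffunE; case: eqP => // ->.
    by apply: contraNneq Ht' => P0; rewrite eH P0 mul0r.
  have PQ : P * Q != 0.
    by apply: contraNneq (mulf_neq0 Pt Qt) => PQ; rewrite -hornerM PQ horner0.
  have [m] := poly_nonroot_seq PQ (natr_inj charL).
  rewrite hornerM mulf_eq0 negb_or => /andP[Pm Qm].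
  exists [ffun j => if j == i then m%:R else t' j]; split.
    by rewrite e // mulf_neq0 // invr_eq0.
  move=> j; rewrite inE ffunE; case: eqP => [_ _|_ /= /st' //].
  by exists m.
have [t' [Ht' nt']] := step (enum I).
have nt i : exists m : nat, t' i == m%:R.
  by have [|m /eqP e] := nt' i; [rewrite mem_enum | exists m].
exists [ffun i => xchoose (nt i)]; rewrite (_ : [ffun i => _] = t') //.
by apply/ffunP => i; rewrite !ffunE; apply/esym/eqP/(xchooseP (nt i)).
Qed.

End RationalGerms.

Section PolynomialExpressions.
Variable V : countType.

(* Syntax is needed only because it is countable. *)
Inductive pexpr := PVar of V | POne | PSub of pexpr & pexpr | PMul of pexpr & pexpr.

Fixpoint pexpr_enc (t : pexpr) : GenTree.tree V :=
  match t with
  | PVar v => GenTree.Leaf v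
  | POne => GenTree.Node 0 [::]
  | PSub a b => GenTree.Node 1 [:: pexpr_enc a; pexpr_enc b]
  | PMul a b => GenTree.Node 2 [:: pexpr_enc a; pexpr_enc b]
  end.

Lemma pexpr_enc_inj : injective pexpr_enc.
Proof.
elim=> [v|| a IHa b IHb|a IHa b IHb] [w|| c d|c d] //=.
- by case=> ->.
- by case=> /IHa-> /IHb->.
- by case=> /IHa-> /IHb->.
Qed.

Fixpoint pvars (t : pexpr) : seq V :=
  match t with
  | PVar v => [:: v]
  | POne => [::]
  | PSub a b | PMul a b => pvars a ++ pvars b
  end.

Fixpoint peval (L : comNzRingType) (e : V -> L) (t : pexpr) : L :=
  match t with
  | PVar v => e v
  | POne => 1
  | PSub a b => peval e a - peval e b
  | PMul a b => peval e a * peval e b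
  end.

Lemma peval_ext (L : comNzRingType) (e e' : V -> L) t :
  (forall v, v \in pvars t -> e v = e' v) -> peval e t = peval e' t.
Proof.
elim: t => [v|| a IHa b IHb|a IHa b IHb] //= ee; first by apply: ee; rewrite inE.
  by rewrite IHa ?IHb // => v vt; apply: ee; rewrite mem_cat vt ?orbT.
by rewrite IHa ?IHb // => v vt; apply: ee; rewrite mem_cat vt ?orbT.
Qed.

Lemma peval_morph (L L' : comNzRingType) (f : {rmorphism L -> L'}) (e : V -> L) t :
  f (peval e t) = peval (f \o e) t.
Proof.
elim: t => [v|| a IHa b IHb|a IHa b IHb] //=; first exact: rmorph1.
  by rewrite rmorphB IHa IHb.
by rewrite rmorphM IHa IHb.
Qed.

Lemma rational_peval (L : fieldType) (s0 : L) (e : L -> V -> L) t :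
  (forall v, v \in pvars t -> rational_at s0 (fun s => e s v)) ->
  rational_at s0 (fun s => peval (e s) t).
Proof.
elim: t => [v|| a IHa b IHb|a IHa b IHb] /= re.
- by apply: re; rewrite inE.
- exact: rational_const.
- by apply: rational_sub; [apply: IHa | apply: IHb] => v vt; apply: re;
    rewrite mem_cat vt ?orbT.
- by apply: rational_mul; [apply: IHa | apply: IHb] => v vt; apply: re;
    rewrite mem_cat vt ?orbT.
Qed.

End PolynomialExpressions.

(** * Frobenius quotients and perturbation of u *)

Section Generic.
Variables (p : nat) (R : idomainType) (phi : {rmorphism R -> R}) (delta : R -> R).
Hypotheses (p_prime : prime p) (HR : Witt_Fpbar R p).
Hypotheses (Hphi : Frob_lift p phi) (Hdelta : delta_spec p phi delta).

Let p0 : (0 < p)%N := prime_gt0 p_prime.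
Let p1 : (1 < p)%N := prime_gt1 p_prime.

Fixpoint phiX k : {rmorphism R -> R} := if k is k'.+1 then phi \o phiX k' else idfun.

Lemma phiXE k x : phiX k x = iter k phi x.
Proof. by elim: k => //= k <-. Qed.

Lemma pdvd_phiX k m x : pdvd p m x -> pdvd p m (phiX k x).
Proof. by move=> h; elim: k => //= k; apply: pdvd_phi. Qed.

(** Teichmüller rigidity: for suitable m the power is congruent to x mod p, and both satisfy phi(y)
    = y^p, which improves the congruence by one digit at a time. *)
Lemma Rdelta_pow x : Rdelta delta x -> exists m, (0 < m)%N /\ x ^+ (p ^ m) = x.
Proof.
move=> dx; have phix : phi x = x ^+ p := Rdelta_phi Hdelta dx.
case: (HR) => _ [_ _ _ _ /(_ x)[m [m0 hm]]]; exists m; split=> //.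
set y := x ^+ (p ^ m) in hm *.
have phiy : phi y = y ^+ p by rewrite rmorphXn phix -!exprM mulnC.
apply/eqP; rewrite -subr_eq0; apply/eqP/(pdvd_all0 HR) => k.
suff : pdvd p k.+1 (y - x) by apply: pdvd_leq.
elim: k => // k IHk; apply: (pdvd_phiV HR (phi := phi)).
by rewrite rmorphB phix phiy; apply: pow_p_cong.
Qed.

Lemma Rdelta_countable : exists c : nat -> R, forall x, Rdelta delta x -> exists i, c i = x.
Proof.
have fin m : exists l : seq R, (0 < m)%N -> forall x, x ^+ (p ^ m) = x -> x \in l.
  case: m => [|m]; first by exists [::].
  have q1 : (1 < p ^ m.+1)%N by rewrite -{1}(exp1n m.+1) ltn_exp2r.
  pose q : {poly R} := 'X^(p ^ m.+1) - 'X.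
  have sq : size q = (p ^ m.+1).+1.
    by rewrite size_polyDl ?size_polyXn // size_polyN size_polyX.
  have q0 : q != 0 by rewrite -size_poly_eq0 sq.
  have [|l [_ lP]] := @finite_enum _ (root q) (p ^ m.+1).
    by move=> s us /allP rs; have := max_poly_roots q0 rs us; rewrite sq.
  exists l => _ x e; apply/lP; rewrite /root /q !hornerE e subrr //.
have [l lP] := choice _ fin.
exists (fun k => if unpickle k is Some mi then nth 0 (l mi.1) mi.2 else 0) => x.
case/Rdelta_pow => m [m0 xm].
exists (pickle (m, index x (l m))); rewrite pickleK /= nth_index //.
exact: lP.
Qed.

(** Take z to be a root modulo p of X q + 1, where q is the product of all X^(p^j) - X^(p^i). Then
    q(z) is nonzero mod p, whereas phi^i z = phi^j z would make one of its factors vanish mod p. The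
    factor X keeps the degree positive when the product is empty. *)
Lemma separating_element r : exists z : R, forall i j, (i < j <= r)%N -> phiX i z != phiX j z.
Proof.
pose s := [seq ij <- [seq (i, j) | i <- iota 0 r.+1, j <- iota 0 r.+1] | ij.1 < ij.2]%N.
pose q : {poly R} := \prod_(ij <- s) ('X^(p ^ ij.2) - 'X^(p ^ ij.1)).
have qm : q \is monic.
  rewrite /q big_filter; apply: rpred_prod => -[i j] /= ij.
  by rewrite monicE lead_coefDl ?lead_coefXn // size_polyN !size_polyXn ltnS ltn_exp2l.
have Xq : 'X * q \is monic by rewrite monicMl ?monicX.
have sXq : (1 < size ('X * q)%R)%N.
  by rewrite mulrC size_mulX ?monic_neq0 // ltnS lt0n size_poly_eq0 monic_neq0.
have s1 : (size (1%R : {poly R}) < size ('X * q)%R)%N by rewrite size_poly1.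
case: (HR) => _ [_ _ _ /(_ ('X * q + 1)) rt _].
have [||z hz] := rt; first by rewrite monicE lead_coefDl // -monicE.
  by rewrite size_polyDl.
exists z => i j /andP[ij jr]; apply/eqP => e.
have q0 : pdvd p 1 q.[z].
  have ij_s : (i, j) \in s.
    rewrite mem_filter; apply/andP; split=> //.
    apply: (allpairs_f (fun i j => (i, j))); rewrite mem_iota add0n ltnS //.
    exact: leq_trans (ltnW ij) jr.
  rewrite /q (big_rem _ ij_s) /= hornerM; apply: pdvdMr.
  rewrite !hornerE; apply: pdvd_trans (_ : pdvd p 1 (iter j phi z - z ^+ (p ^ i))).
    by apply: pdvd_sym; apply: iter_phi_cong.
  by rewrite -phiXE -e phiXE; apply: iter_phi_cong.
apply: (@unit_not_pdvd p R HR 1); first exact: unitr1.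
have -> : 1 = ('X * q + 1).[z] - z * q.[z] by rewrite !hornerE; ring.
by apply: pdvdB => //; apply: pdvdMl.
Qed.

Variable n : nat.
Implicit Types u v g : 'M[R]_n.

(** This is phi^k (1 + p alpha). Multiplied by V(phi^k u) it gives back phi^(k+1) u. *)
Definition frob_quot u k : 'M[R]_n :=
  map_mx (phiX k.+1) u *m invmx (Vmx p (map_mx (phiX k) u)).

Lemma XsetP u : Xset p u <-> close p 1 u 1%:M.
Proof. by []. Qed.

Lemma Xset_unit u : Xset p u -> u \in unitmx.
Proof. by move/XsetP/(close_unit HR); apply; apply: unitmx1. Qed.

Lemma Xset_mul u v : Xset p u -> Xset p v -> Xset p (u *m v).
Proof. by move=> hu hv; apply/XsetP; rewrite -[1%:M]mul1mx; apply: close_mul. Qed.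

Lemma Xset_inv u : Xset p u -> Xset p (invmx u).
Proof.
move=> hu; apply/XsetP; rewrite -invmx1; apply: close_inv => //.
  exact: Xset_unit.
exact: unitmx1.
Qed.

Lemma Xset_Vmx u : Xset p u -> Xset p (Vmx p u).
Proof.
move=> hu; apply/XsetP; have -> : (1%:M : 'M[R]_n) = Vmx p 1%:M; last exact: close_Vmx.
apply/matrixP => i j; rewrite !mxE; case: eqP => _; first by rewrite expr1n.
by rewrite expr0n (gtn_eqF p0).
Qed.

Lemma close_phiX k m u v : close p m u v -> close p m (map_mx (phiX k) u) (map_mx (phiX k) v).
Proof. by move=> h i j; have := pdvd_phiX k (h i j); rewrite !mxE rmorphB. Qed.

Lemma Xset_phiX k u : Xset p u -> Xset p (map_mx (phiX k) u).
Proof. by move=> hu; apply/XsetP; rewrite -(map_mx1 (phiX k)); apply: close_phiX. Qed.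

Lemma Xset_frob_quot u k : Xset p u -> Xset p (frob_quot u k).
Proof.
move=> hu; apply: Xset_mul; first exact: Xset_phiX.
by apply: Xset_inv; apply: Xset_Vmx; apply: Xset_phiX.
Qed.

Lemma close_frob_quot u v k m : Xset p u -> Xset p v -> close p m u v ->
  close p m (frob_quot u k) (frob_quot v k).
Proof.
move=> hu hv uv; apply: close_mul; first exact: close_phiX.
apply: close_inv; last by apply: close_Vmx; apply: close_phiX.
  by apply/Xset_unit/Xset_Vmx/Xset_phiX.
by apply/Xset_unit/Xset_Vmx/Xset_phiX.
Qed.

Lemma phi_frob_quot u k : u \in unitmx ->
  map_mx phi (frob_quot u k) = frob_quot u k.+1.
Proof.
move=> uu; have uk : map_mx (phiX k) u \in unitmx by rewrite unitmxE det_map_mx rmorph_unit.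
have ukS : map_mx (phiX k.+1) u \in unitmx by rewrite unitmxE det_map_mx rmorph_unit.
have uV := Vmx_unit HR Hphi uk; have uVS := Vmx_unit HR Hphi ukS.
have eV : map_mx phi (Vmx p (map_mx (phiX k) u)) = Vmx p (map_mx (phiX k.+1) u).
  by apply/matrixP => i j; rewrite !mxE rmorphXn.
rewrite /frob_quot map_mxM; congr (_ *m _).
  by apply/matrixP => i j; rewrite !mxE.
apply: (can_inj (mulKmx uVS)); rewrite mulmxV // -eV -map_mxM mulmxV //.
exact: map_mx1.
Qed.

Lemma frob_quot_alpha u : u \in unitmx ->
  frob_quot u 0 = p%:R *: alpha_of p delta u + 1%:M.
Proof.
move=> uu; have /(phi_alpha Hdelta) e := alpha_ofE delta HR Hphi uu.
have u0 : map_mx (phiX 0) u = u by apply: map_mx_id.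
have u1 : map_mx (phiX 1) u = map_mx phi u by apply/matrixP => i j; rewrite !mxE.
by rewrite /frob_quot u0 u1 e mulmxK // (Vmx_unit HR Hphi).
Qed.

(** Three kinds of variables: constants of R^delta, entries of the k-th quotient, entries of u. *)
Definition pvar : Type := (nat + (nat * ('I_n * 'I_n)) + 'I_n * 'I_n)%type.
Local Notation expr := (pexpr pvar).

Definition penv (L : comNzRingType) (c : nat -> L) (y : nat -> 'M[L]_n) (x : 'M[L]_n)
    (v : pvar) : L :=
  match v with
  | inl (inl i) => c i
  | inl (inr (k, (i, j))) => y k i j
  | inr (i, j) => x i j
  end.

Variable c : nat -> R.
Hypothesis cP : forall x, Rdelta delta x -> exists i, c i = x.

(** Here the quotients and u are independent variables. Keeping them in X ensures that all matrices
    rebuilt from them are invertible. *)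
Definition nonzero_expr (t : expr) : Prop := exists (y : nat -> 'M[R]_n) (x : 'M[R]_n),
  [/\ forall k, Xset p (y k), Xset p x & peval (penv c y x) t != 0].

Definition dependent (t : expr) u : Prop :=
  [/\ Xset p u, nonzero_expr t & peval (penv c (frob_quot u) u) t = 0].

(** Continuity of the evaluation: a zero set contains its limit points in X. *)
Lemma peval_close u v m t : Xset p u -> Xset p v -> close p m u v ->
  pdvd p m (peval (penv c (frob_quot u) u) t - peval (penv c (frob_quot v) v) t).
Proof.
move=> hu hv uv; elim: t => [[[i|[k [i j]]]|[i j]]|| a IHa b IHb|a IHa b IHb] /=.
- exact: cong_refl.
- by have := close_frob_quot k hu hv uv i j; rewrite !mxE.
- by have := uv i j; rewrite !mxE.
- exact: cong_refl.
- exact: congB.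
- exact: congM.
Qed.

Section Perturbation.
Local Notation L := {fraction R}.
Let f : {rmorphism R -> L} := @FracField.tofrac R.

Let f_inj : injective f.
Proof. by move=> x y /eqP; rewrite tofrac_eq => /eqP. Qed.

Let f_eq0 x : (f x == 0) = (x == 0).
Proof. by rewrite -(inj_eq f_inj) rmorph0. Qed.

(* Unlike invmx, rational in the entries without a case distinction. *)
Definition rat_inv (A : 'M[L]_n) : 'M[L]_n := (\det A)^-1 *: \adj A.

Lemma rat_inv_map (A : 'M[R]_n) : A \in unitmx -> rat_inv (map_mx f A) = map_mx f (invmx A).
Proof.
move=> uA; have ufA : map_mx f A \in unitmx by rewrite unitmxE det_map_mx rmorph_unit.
apply: (can_inj (mulKmx ufA)); rewrite -map_mxM mulmxV // map_mx1.
rewrite /rat_inv -scalemxAr mul_mx_adj scale_scalar_mx mulVf //.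
Qed.

Variables (t : expr) (u0 : 'M[R]_n) (m : nat).
Hypotheses (hu0 : Xset p u0) (nt : nonzero_expr t).

(** Only u, phi u, ..., phi^r u enter the value of t at u. *)
Let r := (\max_(v <- pvars t) if v is inl (inr (k, _)) then k.+1 else 0)%N.

Let r_bound k ij : (inl (inr (k, ij)) : pvar) \in pvars t -> (k < r)%N.
Proof.
by move=> kt; apply: (@leq_bigmax_seq _ _ xpredT
  (fun v : pvar => if v is inl (inr (k, _)) then k.+1 else 0)%N _ kt).
Qed.

Let I : finType := ('I_r.+1 * ('I_n * 'I_n))%type.

Section Coordinates.
Variable z : R.

(** The formula for phi^i of u0 + p^(m+1) sum_j z^j T_j if phi fixed the T_j, as it does when they
    are natural numbers. The exponent m+1 keeps the point in X even for m = 0. *)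
Definition coord_frob (T : {ffun I -> L}) (i : nat) : 'M[L]_n :=
  \matrix_(a, b) (f (phiX i (u0 a b)) +
    f (p%:R ^+ m.+1) * \sum_(j < r.+1) f (phiX i z) ^+ j * T (j, (a, b))).

Let Vf (A : 'M[L]_n) : 'M[L]_n := map_mx (fun x => x ^+ p) A.

(** The determinants are included so that a nonzero value certifies that no denominator vanishes. *)
Definition coord_value (T : {ffun I -> L}) : L :=
  peval (penv (f \o c) (fun k => coord_frob T k.+1 *m rat_inv (Vf (coord_frob T k)))
    (coord_frob T 0)) t * \prod_(k < r) \det (Vf (coord_frob T k)).

Lemma coord_value_rational (T : {ffun I -> L}) : coord_value T != 0 -> forall i,
  rational_at (T i) (fun s => coord_value [ffun j => if j == i then s else T j]).
Proof.
move=> HT i; pose U s : {ffun I -> L} := [ffun j => if j == i then s else T j].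
have UT : U (T i) = T by apply/ffunP => j; rewrite ffunE; case: eqP => // ->.
have rZ k a b : rational_at (T i) (fun s => coord_frob (U s) k a b).
  apply: (@rational_ext _ _ (fun s => f (phiX k (u0 a b)) +
    f (p%:R ^+ m.+1) * \sum_(j < r.+1) f (phiX k z) ^+ j * U s (j, (a, b)))); last first.
    by move=> s; rewrite mxE.
  apply: rational_add; first exact: rational_const.
  apply: rational_mul; first exact: rational_const.
  apply: rational_sum => j; apply: rational_mul; first exact: rational_const.
  have [e|ne] := eqVneq (j, (a, b)) i.
    by apply: rational_ext (rational_id _) _ => s; rewrite ffunE e eqxx.
  by apply: rational_ext (rational_const _ (T (j, (a, b)))) _ => s; rewrite ffunE (negPf ne).
have rV k a b : rational_at (T i) (fun s => Vf (coord_frob (U s) k) a b).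
  by apply: rational_ext (rational_exp p (rZ k a b)) _ => s; rewrite [RHS]mxE.
have rD k : rational_at (T i) (fun s => \det (Vf (coord_frob (U s) k))).
  exact: rational_det.
have D0 (k : 'I_r) : \det (Vf (coord_frob T k)) != 0.
  by apply: contraNneq HT => D0; rewrite /coord_value (bigD1 k) //= D0 mul0r mulr0.
apply: rational_mul; last by apply: rational_prod.
apply: rational_peval => -[[l|[k [a b]]]|[a b]] vt /=.
- exact: rational_const.
- apply: (@rational_ext _ _ (fun s => \sum_d coord_frob (U s) k.+1 a d *
    ((\det (Vf (coord_frob (U s) k)))^-1 *
      ((-1) ^+ (b + d) * \det (row' b (col' d (Vf (coord_frob (U s) k)))))))); last first.
    by move=> s; rewrite mxE; apply: eq_bigr => d _; rewrite !mxE.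
  apply: rational_sum => d; apply: rational_mul => //.
  apply: rational_mul.
    apply: rational_inv => //; rewrite UT; exact: (D0 (Ordinal (r_bound vt))).
  apply: rational_mul; first exact: rational_const.
  apply: rational_det => a' b'.
  by apply: rational_ext (rV k (lift b a') (lift d b')) _ => s; rewrite !mxE.
- exact: rZ.
Qed.

Lemma coord_value_map (T : {ffun I -> L}) (W : nat -> 'M[R]_n) :
    (forall i, (i <= r)%N -> coord_frob T i = map_mx f (W i)) ->
    (forall i, (i <= r)%N -> Xset p (W i)) ->
  coord_value T = f (peval (penv c (fun k => W k.+1 *m invmx (Vmx p (W k))) (W 0)) t)
    * \prod_(k < r) f (\det (Vmx p (W k))).
Proof.
move=> TW XW; have eV i : (i <= r)%N -> Vf (coord_frob T i) = map_mx f (Vmx p (W i)).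
  by move=> ir; rewrite TW //; apply/matrixP => a b; rewrite !mxE rmorphXn.
congr (_ * _); last first.
  by apply: eq_bigr => k _; rewrite eV ?det_map_mx // ltnW.
rewrite peval_morph; apply: peval_ext => -[[l|[k [a b]]]|[a b]] vt //=.
  have kr := r_bound vt.
  rewrite TW // eV ?(ltnW kr) // rat_inv_map -?map_mxM ?mxE //.
  by apply/Xset_unit/Xset_Vmx/XW; apply: ltnW.
by rewrite TW // mxE.
Qed.

End Coordinates.

Lemma perturbation : exists u, [/\ Xset p u, close p m u0 u &
  peval (penv c (frob_quot u) u) t != 0].
Proof.
have [y [x [Xy Xx yx]]] := nt.
have [z zP] := separating_element r.
(* [W i] is the value wanted for phi^i u: with these values the successive quotients are y 0, y 1,
   ... *)
pose W := fix W i := if i is i'.+1 then y i' *m Vmx p (W i') else x.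
have XW i : Xset p (W i).
  by elim: i => //= i IHi; apply: Xset_mul => //; apply: Xset_Vmx.
pose N : 'M[L]_r.+1 := (Vandermonde r.+1 (\row_i f (phiX i z)))^T.
have uN : N \in unitmx.
  rewrite unitmxE unitfE det_tr det_Vandermonde.
  apply/prodf_neq0 => i _; apply/prodf_neq0 => j ij.
  rewrite !mxE subr_eq0 (inj_eq f_inj) eq_sym; apply: zP.
  by rewrite ij -ltnS ltn_ord.
have fp0 : f (p%:R ^+ m.+1) != 0 by rewrite f_eq0 (pX_neq0 HR).
(* Inverting the Vandermonde matrix gives coordinates realising W, possibly with denominators. They
   need not define a point of X; they only show that [coord_value] is not identically zero. *)
pose T : {ffun I -> L} := [ffun jab => (f (p%:R ^+ m.+1))^-1 *
  \sum_(i < r.+1) invmx N jab.1 i * (f (W i jab.2.1 jab.2.2) - f (phiX i (u0 jab.2.1 jab.2.2)))].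
have TW i : (i <= r)%N -> coord_frob z T i = map_mx f (W i).
  move=> ir; pose oi : 'I_r.+1 := Ordinal (ir : (i < r.+1)%N).
  apply/matrixP => a b; rewrite !mxE.
  pose w := \col_(i < r.+1) (f (W i a b) - f (phiX i (u0 a b))).
  have -> : \sum_(j < r.+1) f (phiX i z) ^+ j * T (j, (a, b))
      = (f (p%:R ^+ m.+1))^-1 * (N *m (invmx N *m w)) oi 0.
    rewrite mxE mulr_sumr; apply: eq_bigr => j _.
    rewrite ffunE /= mulrCA !mxE; congr (_ * (_ * _)).
    by apply: eq_bigr => k _; rewrite mxE.
  by rewrite mulKVmx // mxE mulVKf //= addrC subrK.
have HT : coord_value z T != 0.
  rewrite (coord_value_map TW (fun i _ => XW i)); apply: mulf_neq0.
    rewrite f_eq0 (_ : peval _ _ = peval (penv c y x) t) //.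
    apply: peval_ext => -[[l|[k [a b]]]|[a b]] _ //=.
    by rewrite mulmxK //; apply/Xset_unit/Xset_Vmx.
  apply/prodf_neq0 => k _; rewrite f_eq0.
  have : Vmx p (W k) \in unitmx by apply/Xset_unit/Xset_Vmx.
  by rewrite unitmxE; apply: contraTneq => ->; rewrite unitr0.
have charL : [pchar L] =i pred0.
  apply/pcharf0P => k; move/pcharf0P: (char0_R p_prime HR) => <-.
  by rewrite -f_eq0 rmorph_nat.
have [tau Htau] := nonvanishing_at_nat charL (@coord_value_rational z) HT.
pose u : 'M[R]_n := \matrix_(a, b) (u0 a b +
  p%:R ^+ m.+1 * \sum_(j < r.+1) z ^+ j * (tau (j, (a, b)))%:R).
have uu0 : close p m.+1 u u0.
  by move=> a b; rewrite !mxE addrAC subrr add0r; eexists.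
have Xu : Xset p u.
  by apply/XsetP; apply: close_trans hu0; apply: close_leq uu0.
exists u; split=> //; first by apply: close_sym; apply: close_leq uu0.
have Tu i : (i <= r)%N -> coord_frob z [ffun i => (tau i)%:R] i = map_mx f (map_mx (phiX i) u).
  move=> _; apply/matrixP => a b; rewrite !mxE !rmorphD !rmorphM !rmorphXn !rmorph_nat.
  congr (_ + _ * _); rewrite !rmorph_sum; apply: eq_bigr => j _.
  by rewrite ffunE !rmorphM !rmorphXn !rmorph_nat.
move: Htau; rewrite (coord_value_map Tu) => [|i _]; last exact: Xset_phiX.
apply: contraNneq => e; rewrite (_ : peval _ _ = 0) ?rmorph0 ?mul0r // -e.
by apply: peval_ext => -[[l|[k [a b]]]|[a b]] _ //=; rewrite ?mxE.
Qed.

End Perturbation.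

Definition dependent_set u : Prop := exists t, dependent t u.

(** Each piece belongs to one expression. If its closure contained a ball, the expression would
    vanish on the ball by continuity, contrary to [perturbation]. *)
Lemma dependent_set_first_category : first_category_X p dependent_set.
Proof.
split; first by move=> u [t []].
exists (fun k u => exists t, pickle (pexpr_enc t) = k /\ dependent t u); split.
  move=> u; split; last by case=> k [t [_ ?]]; exists t.
  by case=> t bt; exists (pickle (pexpr_enc t)), t.
move=> k [u0 [m [hu0 ball]]].
have [_ /(_ 0%N)[v0 [[t [tk [_ nt _]]] _]]] := ball u0 hu0 (close_refl p m u0).
have [u [hu u0u nu]] := perturbation m hu0 nt.
have [_ cl] := ball u hu u0u; apply/negP: nu => /=; rewrite negbK; apply/eqP.
apply: (pdvd_all0 HR) => l; have [v [[t' [t'k [hv _ ev]]] [_ uv]]] := cl l.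
have tt' : t' = t.
  apply: pexpr_enc_inj; apply: (pcan_inj pickleK).
  by rewrite t'k tk.
by rewrite tt' in ev; have := peval_close t hu hv uv; rewrite ev subr0.
Qed.

End Generic.

(** * The valuation ring attached to u *)

Section QuotientRing.
Variables (p : nat) (R : idomainType) (phi : {rmorphism R -> R}) (delta : R -> R).
Hypotheses (p_prime : prime p) (p_odd : odd p) (HR : Witt_Fpbar R p).
Hypotheses (Hphi : Frob_lift p phi) (Hdelta : delta_spec p phi delta).
Variables (n : nat) (u : 'M[R]_n).
Hypothesis hu : Xset p u.

Definition quot_ring (x : R) : Prop := forall S, subring S ->
  (forall a, Rdelta delta a -> S a) -> (forall k i j, S (frob_quot p phi u k i j)) -> S x.

Definition quot_field (z : {fraction R}) : Prop := exists a b,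
  [/\ quot_ring a, quot_ring b, b != 0 & z = FracField.tofrac a / FracField.tofrac b].

Definition quot_val (x : R) : Prop := quot_field (FracField.tofrac x).

Let uu : u \in unitmx := Xset_unit HR hu.

Lemma quot_ring_subring : subring quot_ring.
Proof.
split; first by move=> S sS _ _; apply: (subring1 sS).
move=> x y hx hy; split=> S sS h1 h2.
  by apply: (subringB sS); [apply: hx | apply: hy].
by apply: (subringM sS); [apply: hx | apply: hy].
Qed.

Lemma quot_ring_frob k i j : quot_ring (frob_quot p phi u k i j).
Proof. by move=> S _ _; apply. Qed.

Lemma quot_ring_phi x : quot_ring x -> quot_ring (phi x).
Proof.
have sB := quot_ring_subring.
move=> /(_ (fun x => quot_ring (phi x))); apply.
- split; first by rewrite rmorph1; apply: (subring1 sB).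
  by move=> a b ha hb; rewrite rmorphB rmorphM; split; [apply: (subringB sB) | apply: (subringM sB)].
- move=> a da; rewrite (Rdelta_phi Hdelta da); apply: (subringX sB).
  by move=> S _ h _; apply: h.
- move=> k i j; have /matrixP/(_ i j) := phi_frob_quot HR Hphi k uu.
  by rewrite mxE => ->; apply: quot_ring_frob.
Qed.

Lemma quot_valP x : quot_val x <-> exists a b,
  [/\ quot_ring a, quot_ring b, b != 0 & b * x = a].
Proof.
split=> -[a [b [ha hb b0 e]]]; exists a, b; split=> //.
  have fb : FracField.tofrac b != 0 by rewrite tofrac_eq0.
  apply/eqP; rewrite -tofrac_eq tofracM e mulrC divfK //.
by rewrite -e tofracM mulrC mulKf // tofrac_eq0.
Qed.

Lemma quot_field_subfield : subfield_K quot_field.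
Proof.
have sB := quot_ring_subring; have B0 := subring0 sB; have B1 := subring1 sB.
split; first by exists 1, 1; rewrite oner_neq0 divff // tofrac_eq0 oner_neq0.
split; last first.
  move=> _ [a [b [ha hb b0 ->]]]; rewrite invf_div.
  have [->|a0] := eqVneq a 0; last by exists b, a.
  by exists 0, 1; rewrite oner_neq0 tofrac0 invr0 mulr0 mul0r.
move=> _ _ [a [b [ha hb b0 ->]]] [a' [b' [ha' hb' b0' ->]]].
have fb : FracField.tofrac b != 0 by rewrite tofrac_eq0.
have fb' : FracField.tofrac b' != 0 by rewrite tofrac_eq0.
split.
  exists (a * b' - a' * b), (b * b'); rewrite mulf_neq0 //; split=> //.
  - by apply: (subringB sB); apply: (subringM sB).
  - exact: (subringM sB).
  - by rewrite tofracM tofracB !tofracM -mulNr addf_div // mulNr.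
exists (a * a'), (b * b'); rewrite mulf_neq0 //; split=> //; try exact: (subringM sB).
by rewrite !tofracM mulf_div.
Qed.

Lemma quot_val_valuation : valuation_subring quot_val.
Proof. by exists quot_field; split; first exact: quot_field_subfield. Qed.

Lemma quot_val_subring : subring quot_val.
Proof.
have [F1 [FBM FV]] := quot_field_subfield; split; first by rewrite /quot_val tofrac1.
by move=> x y hx hy; rewrite /quot_val tofracB tofracM; apply: FBM.
Qed.

Lemma quot_val_base x : quot_ring x -> quot_val x.
Proof.
move=> hx; apply/quot_valP; exists x, 1; rewrite oner_neq0 mul1r; split=> //.
exact: (subring1 quot_ring_subring).
Qed.

(** Since p is invertible in F, stability under phi yields stability under delta, and 1 + p alpha
    over O yields alpha over O. *)
Lemma quot_val_divp x : quot_val (p%:R * x) -> quot_val x.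
Proof.
case/quot_valP => a [b [ha hb b0 e]]; apply/quot_valP; exists a, (b * p%:R).
rewrite mulf_neq0 ?(pR_neq0 HR) // -mulrA; split=> //.
by apply: (subringM quot_ring_subring) => //; apply: (subring_nat quot_ring_subring).
Qed.

Lemma quot_val_delta : delta_subring delta quot_val.
Proof.
have sO := quot_val_subring; split=> // x hx; apply: quot_val_divp.
rewrite Hdelta; apply: (subringB sO); last exact: (subringX sO).
case/quot_valP: hx => a [b [ha hb b0 e]]; apply/quot_valP.
exists (phi a), (phi b); rewrite -rmorphM e; split=> //; try exact: quot_ring_phi.
apply: contraNneq b0 => pb; apply/eqP/(pdvd_all0 HR) => k.
by apply: (pdvd_phiV HR (phi := phi)); rewrite pb; apply: pdvd0.
Qed.

Lemma quot_val_unitV x : x \is a GRing.unit -> quot_val x -> quot_val x^-1.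
Proof.
have [_ [_ FV]] := quot_field_subfield.
by move=> ux /FV; rewrite /quot_val rmorphV.
Qed.

Lemma quot_val_Rdelta x : Rdelta delta x -> quot_val x.
Proof. by move=> dx; apply: quot_val_base => S _ h _; apply: h. Qed.

Lemma quot_val_alpha : mx_over quot_val (alpha_of p delta u).
Proof.
have sO := quot_val_subring; move=> i j; apply: quot_val_divp.
have -> : p%:R * alpha_of p delta u i j = frob_quot p phi u 0 i j - (i == j)%:R.
  rewrite (frob_quot_alpha HR Hphi Hdelta uu); move: (alpha_of _ _ _) => A.
  by rewrite !mxE addrK.
apply: (subringB sO); last exact: (subring_nat sO).
by apply: quot_val_base; apply: quot_ring_frob.
Qed.

Variable c : nat -> R.
Hypothesis cP : forall x, Rdelta delta x -> exists i, c i = x.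

Lemma quot_ring_expr b : quot_ring b -> exists t : pexpr (pvar n),
  forall x, peval (penv c (frob_quot p phi u) x) t = b.
Proof.
move=> /(_ (fun b => exists t : pexpr (pvar n),
  forall x, peval (penv c (frob_quot p phi u) x) t = b)); apply.
- split; first by exists (POne _).
  move=> a b' [ta ea] [tb eb]; split.
    by exists (PSub ta tb) => x /=; rewrite ea eb.
  by exists (PMul ta tb) => x /=; rewrite ea eb.
- by move=> a /cP[i <-]; exists (PVar (inl (inl i) : pvar n)).
- by move=> k i j; exists (PVar (inl (inr (k, (i, j))) : pvar n)).
Qed.

(** Clearing denominators. The expression [td] of the denominator is carried along because the
    numerator of a difference involves both denominators. *)
Lemma polyfun_expr P : polyfun quot_val P -> exists d (td t : pexpr (pvar n)),
  d != 0 /\ forall x, peval (penv c (frob_quot p phi u) x) td = d /\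
    peval (penv c (frob_quot p phi u) x) t = d * P x.
Proof.
elim=> [a /quot_valP[b [d [/quot_ring_expr[tb eb] /quot_ring_expr[td ed] d0 e]]]|i j
  |P1 P2 _ [d1 [s1 [t1 [n1 e1]]]] _ [d2 [s2 [t2 [n2 e2]]]]
  |P1 P2 _ [d1 [s1 [t1 [n1 e1]]]] _ [d2 [s2 [t2 [n2 e2]]]]
  |P1 P2 _ [d1 [s1 [t1 [n1 e1]]]] ee].
- by exists d, td, tb; split=> // x; rewrite eb ed e.
- exists 1, (POne _), (PVar (inr (i, j) : pvar n)); rewrite oner_neq0; split=> // x.
  by rewrite mul1r.
- exists (d1 * d2), (PMul s1 s2), (PSub (PMul t1 s2) (PMul s1 t2)).
  rewrite mulf_neq0 //; split=> // x /=; have [-> ->] := e1 x; have [-> ->] := e2 x.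
  by split=> //; ring.
- exists (d1 * d2), (PMul s1 s2), (PMul t1 t2).
  rewrite mulf_neq0 //; split=> // x /=; have [-> ->] := e1 x; have [-> ->] := e2 x.
  by split=> //; ring.
- by exists d1, s1, t1; split=> // x; rewrite -ee.
Qed.

Hypothesis independent_u : ~ dependent_set p phi c u.

Lemma quot_val_generic P : polyfun quot_val P -> P u = 0 -> forall x, P x = 0.
Proof.
move=> hP Pu x; have [d [td [t [d0 e]]]] := polyfun_expr hP.
have X0 v : Xset p v -> P v = 0.
  move=> hv; apply/eqP; apply: contraT => Pv; case: independent_u; exists t; split=> //.
    exists (frob_quot p phi u), v; split=> //.
      by move=> k; apply: Xset_frob_quot.
    by have [_ ->] := e v; rewrite mulf_neq0.
  by have [_ ->] := e u; rewrite Pu mulr0.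
have [q qE] := polyfun_line 1%:M (x - 1%:M) hP.
suff q0 : q = 0.
  by have := qE 1; rewrite scale1r addrC subrK q0 horner0.
apply/eqP; apply: contraT => nq.
have p_inj : injective (fun m : nat => p%:R * m%:R : R).
  by move=> i j /(mulfI (pR_neq0 HR)) /(natr_inj (char0_R p_prime HR)).
have [m] := poly_nonroot_seq nq p_inj; rewrite -qE X0 ?eqxx // => i j.
by exists (m%:R * (x - 1%:M) i j); rewrite addrAC subrr add0r mxE expr1 mulrA.
Qed.

Lemma quot_val_gal g : Gal_group delta quot_val u g <-> Ndelta delta g.
Proof.
have [sO dO] := quot_val_delta; split.
  exact: (gal_sub_Ndelta p_prime HR Hphi Hdelta sO dO uu quot_val_alpha quot_val_generic).
exact: (Ndelta_sub_gal p_prime p_odd HR Hphi Hdelta sO dO quot_val_unitV quot_val_Rdelta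
  uu quot_val_alpha quot_val_generic).
Qed.

End QuotientRing.

Theorem theorem1p6 (p : nat) (R : idomainType) (phi : {rmorphism R -> R})
    (delta : R -> R) (Ka : closedFieldType)
    (iota : {rmorphism {fraction R} -> Ka}) (n : nat)
    (p_prime : prime p) (p_odd : odd p) (HR : Witt_Fpbar R p)
    (Hphi : Frob_lift p phi) (Hdelta : delta_spec p phi delta)
    (HKa : algebraic_closure_of_K iota) :
  (exists Om : 'M[Ka]_n -> Prop,
      [/\ zariski_closed_GL Om, ~ Om 1%:M &
        forall u : 'M[R]_n, u \in unitmx -> ~ Om (map_mx (toKa iota) u) ->
          forall O : R -> Prop,
            valuation_subring O -> delta_subring delta O ->
            mx_over O (alpha_of p delta u) ->
            has_diag_normal_finite_index iota (Gal_group delta O u)])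
  /\
  (exists Om : 'M[R]_n -> Prop,
      first_category_X p Om /\
      forall u : 'M[R]_n, Xset p u -> ~ Om u ->
        exists O : R -> Prop,
          [/\ valuation_subring O, delta_subring delta O,
              (forall x, Rdelta delta x -> O x),
              mx_over O (alpha_of p delta u) &
              forall g, Gal_group delta O u g <-> Ndelta delta g]).
Proof.
split.
  exists (fun _ => False); split=> //.
    (* The equation 1 = 0 defines the empty set. *)
    exists (fun f => f = 1) => M; split=> // -[_ /(_ 1 erefl)].
    by rewrite meval1 => /eqP; rewrite oner_eq0.
  move=> u uu _ O _ [sO _] aO; apply: locally_finite_virtually_diagonal.
  - exact: char0_R p_prime HR.
  - exact: gal1.
  - by move=> g h; apply: galM.
  - exact: (gal_locally_finite p_prime HR Hphi Hdelta sO uu aO).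
have [c cP] := Rdelta_countable p_prime HR Hdelta.
exists (dependent_set p phi c); split; first exact: dependent_set_first_category.
move=> u hu independent_u; exists (quot_val p phi delta u); split.
- exact: quot_val_valuation.
- exact: quot_val_delta.
- by move=> x; apply: quot_val_Rdelta.
- exact: quot_val_alpha.
- by move=> g; apply: (quot_val_gal p_prime p_odd HR Hphi Hdelta hu cP independent_u).
Qed.
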